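(* Let $y\in\mathcal F_\mathbb Z$ and let $(p,q)$ be a cycle of $y$ with $p<q$. Then $\sum_{z\in\hat\Psi^-(y,p)}\hat F^{\mathrm{FPF}}_z=\sum_{z\in\hat\Psi^+(y,q)}\hat F^{\mathrm{FPF}}_z$.
   Context: Let $S_\mathbb Z$ be the group of finitely supported permutations of $\mathbb Z$, let $s_i=(i,i+1)$, and let $\ell(w)$ be the number of inversions of $w$. Let $\Theta(i)=i-(-1)^i$ and $\mathcal F_\mathbb Z=\{w^{-1}\Theta w:w\in S_\mathbb Z\}$. For $z\in\mathcal F_\mathbb Z$, let $\mathcal A_{\mathrm{FPF}}(z)$ be the set of minimal-length $w$ with $z=w^{-1}\Theta w$. For $w\in S_\mathbb Z$, the Stanley symmetric function is $F_w=\sum_{(a_1,\dots,a_\ell)}\sum x_{i_1}\cdots x_{i_\ell}$. The outer sum is over reduced words $w=s_{a_1}\cdots s_{a_\ell}$. The inner sum is over positive integers $i_1\le\cdots\le i_\ell$ with $i_j<i_{j+1}$ whenever $a_j<a_{j+1}$. Define $\hat F^{\mathrm{FPF}}_z=\sum_{w\in\mathcal A_{\mathrm{FPF}}(z)}F_w$. Let $\hat\ell_{\mathrm{FPF}}(z)=\frac12\#\{(i,j):i<j,\ z(i)>z(j),\ z(i)\ne j\}$. Define $\hat\Psi^+(y,r)=\{z\in\mathcal F_\mathbb Z:\hat\ell_{\mathrm{FPF}}(z)=\hat\ell_{\mathrm{FPF}}(y)+1,\ z=(r,j)y(r,j)\text{ for some integer }j>r\}$ and $\hat\Psi^-(y,r)=\{z\in\mathcal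 F_\mathbb Z:\hat\ell_{\mathrm{FPF}}(z)=\hat\ell_{\mathrm{FPF}}(y)+1,\ z=(i,r)y(i,r)\text{ for some integer }i<r\}$. *)

(* Defs.v *)
From Stdlib Require Import ZArith Arith List Classical ClassicalEpsilon.
Import ListNotations.
Open Scope Z_scope.

Definition enumerates {T : Type} (P : T -> Prop) (s : list T) : Prop :=
  NoDup s /\ forall x, In x s <-> P x.

(* Sum of f over the set P, when P is finite (well defined: independent of
   the enumeration); by convention 0 when P is infinite (as Mathlib's finsum). *)
Definition fsum {T : Type} (P : T -> Prop) (f : T -> nat) : nat :=
  match excluded_middle_informative (exists s, enumerates P s) with
  | left H => list_sum (map f (proj1_sig (constructive_indefinite_description _ H)))
  | right _ => 0%nat
  end.

Definition ncard {T : Type} (P : T -> Prop) : nat := fsum P (fun _ => 1%nat).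

Definition transp (a b : Z) (x : Z) : Z :=
  if x =? a then b else if x =? b then a else x.

Definition s_ (i : Z) : Z -> Z := transp i (i + 1).

Definition in_SZ (w : Z -> Z) : Prop :=
  (exists winv : Z -> Z, forall x, winv (w x) = x /\ w (winv x) = x) /\
  (exists N : Z, forall i, N < Z.abs i -> w i = i).

Definition ell (w : Z -> Z) : nat :=
  ncard (fun ij : Z * Z => fst ij < snd ij /\ w (fst ij) > w (snd ij)).

(* Θ(i) = i - (-1)^i, i.e. i-1 for even i and i+1 for odd i.
   (Written by parity because Stdlib's Z.pow is 0 for negative exponents.) *)
Definition Theta (i : Z) : Z := if Z.even i then i - 1 else i + 1.

(* z = w^{-1} Θ w  (functions composed right to left); for bijective w this
   is equivalent to w ∘ z = Θ ∘ w. *)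
Definition twisted (w z : Z -> Z) : Prop := forall x, w (z x) = Theta (w x).

Definition in_FZ (z : Z -> Z) : Prop := exists w, in_SZ w /\ twisted w z.

Definition A_FPF (z : Z -> Z) (w : Z -> Z) : Prop :=
  in_SZ w /\ twisted w z /\
  forall v, in_SZ v -> twisted v z -> (ell w <= ell v)%nat.

Definition word_perm (a : list Z) : Z -> Z :=
  fold_right (fun i f => fun x => s_ i (f x)) (fun x => x) a.

Definition reduced_word (w : Z -> Z) (a : list Z) : Prop :=
  length a = ell w /\ forall x, w x = word_perm a x.

Definition compatible (a : list Z) (i : list nat) : Prop :=
  length i = length a /\
  (forall j, (j < length i)%nat -> (1 <= nth j i 0%nat)%nat) /\
  (forall j, (S j < length a)%nat ->
      (nth j i 0%nat <= nth (S j) i 0%nat)%nat /\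
      (nth j a 0 < nth (S j) a 0 -> (nth j i 0%nat < nth (S j) i 0%nat)%nat)).

(* A formal power series in x_1, x_2, ... is represented by its coefficient
   function on monomials; a monomial prod_k x_k^(e k) is given by its exponent
   vector e : nat -> nat.  The monomial x_{i_1} ... x_{i_l} has exponent
   vector k |-> #{j | i_j = k}. *)
Definition monomial_of (i : list nat) (e : nat -> nat) : Prop :=
  forall k, e k = count_occ Nat.eq_dec i k.

Definition stanley_coeff (w : Z -> Z) (e : nat -> nat) : nat :=
  ncard (fun ai : list Z * list nat =>
           reduced_word w (fst ai) /\ compatible (fst ai) (snd ai) /\
           monomial_of (snd ai) e).

Definition FhatFPF_coeff (z : Z -> Z) (e : nat -> nat) : nat :=
  fsum (A_FPF z) (fun w => stanley_coeff w e).

Definition ellhat_FPF (z : Z -> Z) : nat :=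
  Nat.div (ncard (fun ij : Z * Z =>
     fst ij < snd ij /\ z (fst ij) > z (snd ij) /\ z (fst ij) <> snd ij)) 2.

Definition PsiPlus (y : Z -> Z) (r : Z) (z : Z -> Z) : Prop :=
  in_FZ z /\ ellhat_FPF z = (ellhat_FPF y + 1)%nat /\
  exists j, j > r /\ forall x, z x = transp r j (y (transp r j x)).

Definition PsiMinus (y : Z -> Z) (r : Z) (z : Z -> Z) : Prop :=
  in_FZ z /\ ellhat_FPF z = (ellhat_FPF y + 1)%nat /\
  exists i, i < r /\ forall x, z x = transp i r (y (transp i r x)).

(* Main.v *)
Require Import Defs.
From Stdlib Require Import ZArith Arith List.
From Stdlib Require Import Lia Bool Permutation Classical ClassicalEpsilon FunctionalExtensionality.
Import ListNotations.
Open Scope Z_scope.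

(** Write [u_i z] for [s_i z s_i] if [i] is a descent of [z] with [z i <> i + 1], and [0]
    otherwise: it is [0] or an involution whose FPF-length is one less.  The coefficient of
    [x^e] in [F^FPF_z] counts the ways to reduce [z] to [Theta] by applying the [u_i] in rows,
    one row per variable, the indices increasing within a row.  For a cycle [C = {p < q}] of
    [y] let [M(y, C)] be the formal sum of the elements of [Psi^+(y, q)] minus those of
    [Psi^-(y, p)].  A length comparison shows
      [u_i M(y, C) = M(u_i y, s_i C) + ([i in C] - [i + 1 in C]) y],
    so, processing the indices of a row upwards, the defect [[b in C] y] is passed from index
    [b] to index [b + 1] and disappears at both ends of the row.  Hence every coefficient
    functional kills [M(y, C)], by induction on the number of letters. *)

(** * Sums over finite sets *)

(** The induction needs a statement about incomplete rows. A cover has one letter more than [y];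
    among words whose first stripped letter is at least [b], the signed count of the covers is
    [[b in C]] times a count of words of [y] with one label of the current row deleted. Lowering
    [b + 1] to [b] moves the defect accordingly, and since [s_b] carries [b in C] to
    [b + 1 in s_b C], the hypothesis for [u_b y] supplies just the words of [y] that begin with [b].
    The defect comes from a single cover. If [i] is an ascent of [y], it is [s_i y s_i], which [u_i]
    returns to [y]; if [i] is a descent, it is [y], which may cover [u_i y] without coming from a
    cover of [y]. Conjugations by [(a, b)] and by [(y a, y b)] agree when [y a <> b], so both
    elements of [C] contribute. As [Theta] moves every integer, inversions are counted in finite
    intervals that are unions of its cycles. Covers need an interval one cycle longer at each end,
    and its lowest index then misses [C]. *)

Definition finite {T : Type} (P : T -> Prop) : Prop := exists s, enumerates P s.

Lemma list_sum_perm (s t : list nat) : Permutation s t -> list_sum s = list_sum t.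
Proof. induction 1; simpl in *; lia. Qed.

Lemma fsum_enum {T} (P : T -> Prop) f s :
  enumerates P s -> fsum P f = list_sum (map f s).
Proof.
  intros H. unfold fsum. destruct excluded_middle_informative as [E|E].
  - destruct (constructive_indefinite_description _ E) as [t Ht]; simpl.
    apply list_sum_perm, Permutation_map, NoDup_Permutation.
    + apply Ht. + apply H.
    + intros x. rewrite (proj2 Ht), (proj2 H). tauto.
  - exfalso. apply E. now exists s.
Qed.

Lemma ncard_enum {T} (P : T -> Prop) s : enumerates P s -> ncard P = length s.
Proof.
  intros H. unfold ncard. rewrite (fsum_enum _ _ _ H). clear H.
  induction s; simpl; lia.
Qed.

Lemma fin_incl {T} (P : T -> Prop) l : (forall x, P x -> In x l) -> finite P.
Proof.
  intros H.
  assert (D : forall x y : T, {x = y} + {x <> y})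
    by (intros; apply excluded_middle_informative).
  pose (b := fun x => if excluded_middle_informative (P x) then true else false).
  exists (nodup D (filter b l)). split; [apply NoDup_nodup|].
  intros x. rewrite nodup_In, filter_In. unfold b.
  destruct excluded_middle_informative; split; intuition (auto; try discriminate).
Qed.

Lemma fin_sub {T} (P Q : T -> Prop) : finite Q -> (forall x, P x -> Q x) -> finite P.
Proof. intros [s Hs] H. apply (fin_incl P s). intros x Hx. apply Hs; auto. Qed.

Lemma fsum_ext {T} (P Q : T -> Prop) f g :
  (forall x, P x <-> Q x) -> (forall x, P x -> f x = g x) -> fsum P f = fsum Q g.
Proof.
  intros H Hf. destruct (classic (finite P)) as [[s Hs]|N].
  - rewrite (fsum_enum P f s Hs), (fsum_enum Q g s).
    + f_equal. apply map_ext_in. intros x Hx. apply Hf, Hs, Hx.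
    + split; [apply Hs|]. intros x. rewrite (proj2 Hs). apply H.
  - unfold fsum. destruct excluded_middle_informative as [E|E]; [now elim N|].
    destruct excluded_middle_informative as [E'|E']; [|reflexivity].
    elim N. destruct E' as [s Hs]. apply (fin_sub P Q); [now exists s|]. firstorder.
Qed.

Lemma fsum_bij {S T} (P : S -> Prop) (Q : T -> Prop) (h : S -> T) (k : T -> S) f :
  (forall x, P x -> Q (h x) /\ k (h x) = x) ->
  (forall x, Q x -> P (k x) /\ h (k x) = x) ->
  fsum Q f = fsum P (fun x => f (h x)).
Proof.
  intros HP HQ.
  assert (B : forall {S T} (P : S -> Prop) (Q : T -> Prop) h k s,
    (forall x, P x -> Q (h x) /\ k (h x) = x) ->
    (forall x, Q x -> P (k x) /\ h (k x) = x) ->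
    enumerates P s -> enumerates Q (map h s)).
  { clear. intros S T P Q h k s HP HQ [Hn Hs]. split.
    - assert (Hs' : forall x, In x s -> k (h x) = x) by (intros; apply HP, Hs; auto).
      clear - Hn Hs'. induction Hn as [|x l Hx Hl IH]; simpl; constructor.
      + rewrite in_map_iff. intros (y & E & Hy). apply Hx.
        rewrite <- (Hs' x), <- E, Hs'; simpl; auto.
      + apply IH. simpl in Hs'; auto.
    - intros x. rewrite in_map_iff. split.
      + intros (y & <- & Hy). now apply HP, Hs.
      + intros Hx. exists (k x). split; [apply HQ; auto|]. apply Hs, HQ, Hx. }
  destruct (classic (finite P)) as [[s Hs]|N].
  - rewrite (fsum_enum P _ s Hs), (fsum_enum Q f (map h s)) by eauto.
    now rewrite map_map.
  - unfold fsum. destruct excluded_middle_informative as [E|E].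
    + elim N. destruct E as [s Hs]. exists (map k s). eauto.
    + destruct excluded_middle_informative as [E'|E']; [now elim N|reflexivity].
Qed.

Lemma fsum_split {T} (P : T -> Prop) (Q : T -> Prop) f :
  finite P -> fsum P f = (fsum (fun x => P x /\ Q x) f + fsum (fun x => P x /\ ~ Q x) f)%nat.
Proof.
  intros [s [Hn Hs]].
  pose (b := fun x => if excluded_middle_informative (Q x) then true else false).
  rewrite (fsum_enum P f s) by (split; auto).
  rewrite (fsum_enum _ f (filter b s)).
  2:{ split; [now apply NoDup_filter|]. intros x. rewrite filter_In, Hs. unfold b.
      destruct excluded_middle_informative; intuition discriminate. }
  rewrite (fsum_enum _ f (filter (fun x => negb (b x)) s)).
  2:{ split; [now apply NoDup_filter|]. intros x. rewrite filter_In, Hs. unfold b.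
      destruct excluded_middle_informative; simpl; intuition discriminate. }
  clear. induction s as [|x s IH]; simpl; [reflexivity|].
  destruct (b x); simpl; lia.
Qed.

Lemma fsum_0 {T} (P : T -> Prop) f : (forall x, P x -> f x = 0%nat) -> fsum P f = 0%nat.
Proof.
  intros H. destruct (classic (finite P)) as [[s Hs']|N].
  2:{ unfold fsum. destruct excluded_middle_informative; [contradiction|reflexivity]. }
  rewrite (fsum_enum P f s Hs'). destruct Hs' as [_ Hs].
  assert (H' : forall x, In x s -> f x = 0%nat) by (intros; apply H, Hs; auto).
  clear - H'. induction s; simpl in *; [reflexivity|]. rewrite H', IHs; auto.
Qed.

Lemma fsum_sing {T} (P : T -> Prop) f x0 :
  (forall x, P x <-> x = x0) -> fsum P f = f x0.
Proof.
  intros H. rewrite (fsum_enum P f [x0]); [simpl; lia|].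
  split; [constructor; auto; constructor|]. intros x; rewrite H; simpl; intuition auto.
Qed.

Lemma fsum_remove {T} (P : T -> Prop) f x0 :
  finite P -> P x0 -> fsum P f = (f x0 + fsum (fun x => P x /\ x <> x0) f)%nat.
Proof.
  intros F H. rewrite (fsum_split P (fun x => x = x0) f F). f_equal.
  apply fsum_sing. intros x; split; [tauto|intros ->; auto].
Qed.

Lemma fsum_restrict {T} (P Q : T -> Prop) f :
  finite P -> (forall x, P x -> ~ Q x -> f x = 0%nat) ->
  fsum P f = fsum (fun x => P x /\ Q x) f.
Proof.
  intros F H. rewrite (fsum_split P Q f F), (fsum_0 (fun x => P x /\ ~ Q x)); [lia|].
  intros x []; auto.
Qed.

Lemma fsum_add {T} (P : T -> Prop) f g :
  finite P -> fsum P (fun x => f x + g x)%nat = (fsum P f + fsum P g)%nat.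
Proof.
  intros [s Hs]. rewrite !(fsum_enum P _ s Hs). clear. induction s; simpl; lia.
Qed.

(** Merges the sum over atoms with the count of reduced words of each atom into one count of
    words. *)
Lemma fsum_fibres {S T} (P : S -> Prop) (Q : T -> Prop) (h : T -> S) :
  finite P -> finite Q -> (forall x, Q x -> P (h x)) ->
  fsum P (fun w => ncard (fun x => Q x /\ h x = w)) = ncard Q.
Proof.
  intros [l [Hl Il]] [s Hs] H.
  pose (b := fun w x => if excluded_middle_informative (h x = w) then true else false).
  rewrite (ncard_enum Q s Hs), (fsum_enum P _ l) by (split; auto).
  rewrite (map_ext _ (fun w => length (filter (b w) s))).
  2:{ intros w. apply ncard_enum. split; [apply NoDup_filter, Hs|].
      intros x. rewrite filter_In, (proj2 Hs). unfold b.
      destruct excluded_middle_informative; intuition discriminate. }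
  assert (H' : forall x, In x s -> In (h x) l) by (intros; apply Il, H, Hs; auto).
  clear - Hl H'. induction s as [|x s IH]; simpl in *.
  - clear. induction l; simpl; auto.
  - rewrite <- IH by auto. specialize (H' x (or_introl eq_refl)). clear IH.
    (* A new [x] enlarges the fibre over [h x] and no other; [NoDup l] makes it count once. *)
    assert (G : forall l, NoDup l ->
      list_sum (map (fun w => length (if b w x then x :: filter (b w) s else filter (b w) s)) l)
      = ((if excluded_middle_informative (In (h x) l) then 1 else 0)
         + list_sum (map (fun w => length (filter (b w) s)) l))%nat).
    { clear. induction l as [|w l IH]; intros Hn; simpl.
      - destruct excluded_middle_informative; tauto.
      - inversion_clear Hn. rewrite IH by auto.
        assert (B : b w x = true <-> h x = w)
          by (unfold b; destruct (excluded_middle_informative (h x = w)); split; intros; congruence).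
        destruct (b w x); cbn [length];
        destruct (excluded_middle_informative (In (h x) l)) as [I|I];
        destruct (excluded_middle_informative (w = h x \/ In (h x) l)) as [J|J]; try lia;
        exfalso; destruct (classic (h x = w)) as [E|E]; try rewrite E in *;
        intuition congruence. }
    rewrite G by auto. destruct excluded_middle_informative; tauto.
Qed.

Lemma fin_Zint lo hi : exists l, forall x, lo <= x <= hi -> In x l.
Proof.
  exists (map (fun k => lo + Z.of_nat k) (seq 0 (Z.to_nat (hi - lo + 1)))).
  intros x Hx. apply in_map_iff. exists (Z.to_nat (x - lo)).
  rewrite in_seq. lia.
Qed.

Lemma fin_words lo hi n :
  finite (fun a : list Z => length a = n /\ forall x, In x a -> lo <= x <= hi).
Proof.
  destruct (fin_Zint lo hi) as [l Hl].
  assert (H : exists L, forall a : list Z, length a = n /\ (forall x, In x a -> lo <= x <= hi) -> In a L).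
  2:{ destruct H as [L HL]. now apply (fin_incl _ L). }
  induction n as [|n [L IH]].
  - exists [[]]. intros [|? ?] [H _]; simpl; [auto|discriminate].
  - exists (map (fun p => fst p :: snd p) (list_prod l L)).
    intros [|c a] [H Ha]; [discriminate|]. apply in_map_iff. exists (c, a).
    split; [reflexivity|]. apply in_prod.
    + apply Hl, Ha; simpl; auto.
    + apply IH. split; [simpl in H; lia|]. simpl in Ha; auto.
Qed.

(** * Inversions *)

Ltac transp_cases := unfold s_, transp in *;
  repeat match goal with
  | |- context [?a =? ?b] => destruct (Z.eqb_spec a b)
  | H : context [?a =? ?b] |- _ => destruct (Z.eqb_spec a b)
  end; try subst; try lia.

Lemma transp_invol a b x : transp a b (transp a b x) = x.
Proof. transp_cases. Qed.

Lemma transp_sym a b : transp a b = transp b a.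
Proof. apply functional_extensionality; intros x. transp_cases. Qed.

Lemma transp_other a b x : x <> a -> x <> b -> transp a b x = x.
Proof. transp_cases. Qed.

Lemma transp_l a b : transp a b a = b.
Proof. transp_cases. Qed.

Lemma transp_r a b : transp a b b = a.
Proof. transp_cases. Qed.

Lemma transp_inj a b x y : transp a b x = transp a b y -> x = y.
Proof. transp_cases. Qed.

Lemma s_invol i x : s_ i (s_ i x) = x.
Proof. apply transp_invol. Qed.

Lemma s_lt i x y : x < y -> ~ (x = i /\ y = i + 1) -> s_ i x < s_ i y.
Proof. transp_cases. Qed.

(** The domain [D] is all of [Z] for finitely supported permutations. Elements of [F_Z] have
    infinitely many inversions, so for them [D] is a finite window. *)
Definition invs (D : Z -> Prop) (w : Z -> Z) (xy : Z * Z) : Prop :=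
  D (fst xy) /\ D (snd xy) /\ fst xy < snd xy /\ w (fst xy) > w (snd xy).

(** Applying [s_i] to both entries preserves the order of every pair except [(i, i + 1)], which
    becomes the one new inversion. *)
Lemma inv_asc (D : Z -> Prop) w i :
  D i -> D (i + 1) -> finite (invs D (fun x => w (s_ i x))) -> w i < w (i + 1) ->
  ncard (invs D (fun x => w (s_ i x))) = S (ncard (invs D w)).
Proof.
  intros D1 D2 F A.
  assert (Ds : forall x, D x -> D (s_ i x)) by (intros; transp_cases; auto).
  unfold ncard. rewrite (fsum_remove _ _ (i, i + 1) F).
  2:{ unfold invs; cbn [fst snd]. repeat split; auto; try lia.
      unfold s_. rewrite transp_l, transp_r. lia. }
  simpl. f_equal.
  apply (fsum_bij (invs D w) _ (fun p => (s_ i (fst p), s_ i (snd p)))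
    (fun p => (s_ i (fst p), s_ i (snd p))) (fun _ => 1%nat)).
  - intros [x y] (H1 & H2 & H3 & H4); cbn [fst snd] in *.
    rewrite !s_invol. repeat split; cbn [fst snd]; auto; rewrite ?s_invol; auto.
    + apply s_lt; auto. intros [-> ->]; lia.
    + intros E. injection E as E1 E2. apply (f_equal (s_ i)) in E1, E2.
      rewrite s_invol in E1, E2. transp_cases.
  - intros [x y] ((H1 & H2 & H3 & H4) & N); cbn [fst snd] in *.
    rewrite !s_invol. repeat split; cbn [fst snd]; auto.
    apply s_lt; auto. intros [-> ->]; now apply N.
Qed.

Lemma inv_desc (D : Z -> Prop) w i :
  D i -> D (i + 1) -> finite (invs D w) -> w (i + 1) < w i ->
  ncard (invs D w) = S (ncard (invs D (fun x => w (s_ i x)))).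
Proof.
  intros D1 D2 F A.
  assert (E : (fun x => w (s_ i (s_ i x))) = w).
  { apply functional_extensionality; intros. now rewrite s_invol. }
  rewrite <- E in F. rewrite <- E at 1.
  apply (inv_asc D (fun x => w (s_ i x))); auto.
  unfold s_. now rewrite transp_l, transp_r.
Qed.

Lemma inv_inverse (D : Z -> Prop) w v :
  (forall x, D x -> D (w x)) -> (forall x, D x -> D (v x)) ->
  (forall x, v (w x) = x) -> (forall x, w (v x) = x) ->
  ncard (invs D v) = ncard (invs D w).
Proof.
  intros Dw Dv vw wv.
  apply (fsum_bij (invs D w) _ (fun p => (w (snd p), w (fst p)))
    (fun p => (v (snd p), v (fst p))) (fun _ => 1%nat));
  intros [x y] (H1 & H2 & H3 & H4); cbn [fst snd] in *; unfold invs; cbn [fst snd];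
  rewrite ?vw, ?wv; repeat split; auto; lia.
Qed.

Lemma s_transp_s a b x : a + 1 < b ->
  s_ a (transp (a + 1) b (s_ a x)) = transp a b x.
Proof. intros. transp_cases. Qed.

(** Induction on [b - a] through [(a, b) = s_a (a + 1, b) s_a]. The two outer factors change the
    count by one each, the middle one raises it. They cannot both lower it: if the first does, then
    [w (a + 1) < w a < w b], so the last raises it. *)
Lemma inv_transp_lt lo hi w a b :
  (forall x y, w x = w y -> x = y) ->
  lo <= a -> a < b -> b <= hi -> w a < w b ->
  (ncard (invs (fun x => lo <= x <= hi)%Z w)
    < ncard (invs (fun x => lo <= x <= hi)%Z (fun x => w (transp a b x))))%nat.
Proof.
  set (D := fun x => lo <= x <= hi).
  assert (F : forall v, finite (invs D v)).
  { intros v. destruct (fin_Zint lo hi) as [l Hl]. apply (fin_incl _ (list_prod l l)).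
    intros [x y] (H1 & H2 & _). apply in_prod; now apply Hl. }
  intros Hi La Lab Lb. revert w Hi a La Lab.
  assert (G : forall n w a, (forall x y, w x = w y -> x = y) ->
    lo <= a -> a < b -> (Z.to_nat (b - a) <= n)%nat -> w a < w b ->
    (ncard (invs D w) < ncard (invs D (fun x => w (transp a b x))))%nat).
  2:{ intros; eapply G; eauto. }
  induction n as [|n IH]; intros w a Hi La Lab Hn Hw; [lia|].
  assert (Da : D a /\ D (a + 1)) by (unfold D; lia). destruct Da as [Da Da1].
  destruct (Z.eq_dec b (a + 1)) as [->|N].
  { change (fun x => w (transp a (a + 1) x)) with (fun x => w (s_ a x)).
    rewrite inv_asc; auto. }
  set (w1 := fun x => w (s_ a x)).
  set (w2 := fun x => w1 (transp (a + 1) b x)).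
  assert (E : (fun x => w (transp a b x)) = (fun x => w2 (s_ a x))).
  { apply functional_extensionality; intros x. unfold w2, w1.
    now rewrite s_transp_s by lia. }
  rewrite E.
  assert (I : (ncard (invs D w1) < ncard (invs D w2))%nat).
  { apply IH; try lia.
    - intros x y H. apply Hi in H. now apply transp_inj in H.
    - unfold w1. replace (s_ a (a + 1)) with a by transp_cases. replace (s_ a b) with b by transp_cases. auto. }
  assert (V1 : w2 a = w (a + 1)).
  { unfold w2, w1. f_equal. transp_cases. }
  assert (V2 : w2 (a + 1) = w b).
  { unfold w2, w1. f_equal. transp_cases. }
  assert (C : w (a + 1) <> w a /\ w (a + 1) <> w b).
  { split; intros C; apply Hi in C; lia. }
  assert (A1 : ncard (invs D w1) = S (ncard (invs D w)) /\ w a < w (a + 1) \/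
               ncard (invs D w) = S (ncard (invs D w1)) /\ w (a + 1) < w a).
  { destruct (Z_lt_le_dec (w a) (w (a + 1))); [left|right; assert (w (a+1) < w a) by lia].
    - split; auto. unfold w1. now rewrite inv_asc.
    - split; auto. now apply inv_desc. }
  assert (A2 : ncard (invs D (fun x => w2 (s_ a x))) = S (ncard (invs D w2)) /\ w2 a < w2 (a + 1) \/
               ncard (invs D w2) = S (ncard (invs D (fun x => w2 (s_ a x)))) /\ w2 (a + 1) < w2 a).
  { destruct (Z_lt_le_dec (w2 a) (w2 (a + 1))); [left|right; assert (w2 (a+1) < w2 a) by lia].
    - split; auto. now rewrite inv_asc.
    - split; auto. now apply inv_desc. }
  lia.
Qed.

(** * Fixed-point-free involutions and their length *)

Definition tconj (a b : Z) (y : Z -> Z) : Z -> Z := fun x => transp a b (y (transp a b x)).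
Definition fpf (z : Z -> Z) : Prop := (forall x, z (z x) = x) /\ (forall x, z x <> x).
(* The window is a union of cycles of [Theta]. *)
Definition window (N x : Z) : Prop := 1 - 2 * N <= x <= 2 * N.
Definition supp (N : Z) (z : Z -> Z) : Prop := forall x, ~ window N x -> z x = Theta x.

Lemma Theta_spec x : exists k, (x = 2 * k /\ Theta x = 2 * k - 1) \/ (x = 2 * k - 1 /\ Theta x = 2 * k).
Proof.
  unfold Theta. destruct (Z.even x) eqn:E.
  - apply Z.even_spec in E. destruct E as [k ->]. exists k. lia.
  - assert (O : Z.odd x = true) by (rewrite <- Z.negb_even, E; auto).
    apply Z.odd_spec in O. destruct O as [k ->]. exists (k + 1). lia.
Qed.

Lemma fpf_Theta : fpf Theta.
Proof.
  split; intros x; destruct (Theta_spec x) as [k Hk];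
  destruct (Theta_spec (Theta x)) as [l Hl]; lia.
Qed.

Lemma supp_mono N M z : N <= M -> supp N z -> supp M z.
Proof. intros L H x Hx. apply H. unfold window in *. lia. Qed.

Lemma SZ_inj w : in_SZ w -> forall x y, w x = w y -> x = y.
Proof. intros [[v Hv] _] x y E. rewrite <- (proj1 (Hv x)), E. apply Hv. Qed.

Lemma FZ_fpf z : in_FZ z -> fpf z.
Proof.
  intros (w & Hw & T). pose proof (SZ_inj w Hw) as I. unfold twisted in T. split; intros x.
  - apply I. rewrite !T. apply fpf_Theta.
  - intros E. apply (f_equal w) in E. rewrite T in E. now apply fpf_Theta in E.
Qed.

Lemma FZ_supp z : in_FZ z -> exists N, 0 <= N /\ supp N z.
Proof.
  intros (w & Hw & T). pose proof (SZ_inj w Hw) as I. destruct Hw as [_ [N HN]].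
  exists (Z.abs N + 1). split; [lia|]. intros x Hx. unfold window in Hx.
  destruct (Theta_spec x) as [k Hk].
  apply I. rewrite T, (HN x) by lia. rewrite HN; lia.
Qed.

Lemma in_SZ_transp w a b : in_SZ w -> in_SZ (fun x => w (transp a b x)).
Proof.
  intros [[v Hv] [N HN]]. split.
  - exists (fun x => transp a b (v x)). intros x. rewrite (proj1 (Hv _)), !transp_invol.
    split; [reflexivity|]. apply Hv.
  - exists (Z.abs N + Z.abs a + Z.abs b). intros i Hi.
    rewrite transp_other by lia. apply HN. lia.
Qed.

Lemma tconj_invol a b z : tconj a b (tconj a b z) = z.
Proof.
  apply functional_extensionality; intros x. unfold tconj. now rewrite !transp_invol.
Qed.

Lemma tconj_sym a b : tconj a b = tconj b a.
Proof. unfold tconj. now rewrite transp_sym. Qed.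

Lemma twisted_tconj w z a b :
  twisted w z -> twisted (fun x => w (transp a b x)) (tconj a b z).
Proof. intros T x. unfold tconj. rewrite transp_invol. apply T. Qed.

Lemma FZ_tconj a b z : in_FZ z -> in_FZ (tconj a b z).
Proof.
  intros (w & Hw & T). exists (fun x => w (transp a b x)).
  split; [now apply in_SZ_transp|now apply twisted_tconj].
Qed.

Lemma fpf_tconj a b z : fpf z -> fpf (tconj a b z).
Proof.
  intros [H1 H2]. unfold tconj. split; intros x.
  - now rewrite transp_invol, H1, transp_invol.
  - intros E. apply (f_equal (transp a b)) in E. rewrite transp_invol in E. now apply H2 in E.
Qed.

Lemma fpf_inj z : fpf z -> forall x y, z x = z y -> x = y.
Proof. intros [H _] x y E. rewrite <- (H x), E. apply H. Qed.

Lemma window_dec N x : {window N x} + {~ window N x}.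
Proof. apply excluded_middle_informative. Qed.

Lemma supp_window N z x : fpf z -> supp N z -> window N x -> window N (z x).
Proof.
  intros F S W. destruct (window_dec N (z x)) as [|Nw]; auto. exfalso.
  pose proof (S _ Nw) as E. rewrite (proj1 F) in E.
  destruct (Theta_spec (z x)) as [k Hk]. unfold window in *. lia.
Qed.

Lemma supp_tconj N a b z : fpf z -> supp N z -> window N a -> window N b -> supp N (tconj a b z).
Proof.
  intros F S Wa Wb x Wx. unfold tconj.
  rewrite (transp_other a b x) by (intros ->; auto). rewrite (S x Wx).
  apply transp_other; intros E; destruct (Theta_spec x) as [k Hk]; unfold window in *; lia.
Qed.

Definition fpf_inv (z : Z -> Z) (ij : Z * Z) : Prop :=
  fst ij < snd ij /\ z (fst ij) > z (snd ij) /\ z (fst ij) <> snd ij.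

Lemma fin_invs_window N z : finite (invs (window N) z).
Proof.
  destruct (fin_Zint (1 - 2 * N) (2 * N)) as [l Hl]. apply (fin_incl _ (list_prod l l)).
  intros [x y] (H1 & H2 & _). apply in_prod; now apply Hl.
Qed.

(* The window has [2 N] points, hence [N] cycles, each of which is an inversion of [z]. *)
Lemma inv_fpf_inv N z : fpf z -> supp N z ->
  (2 * ncard (invs (window N) z) = 2 * ncard (fpf_inv z) + ncard (window N))%nat.
Proof.
  intros F Sz. pose proof (proj1 F) as I. pose proof (proj2 F) as NF.
  unfold ncard. rewrite (fsum_split (invs (window N) z) (fun p => z (fst p) = snd p)) by apply fin_invs_window.
  assert (E1 : fsum (fun p => invs (window N) z p /\ z (fst p) <> snd p) (fun _ => 1%nat)
             = fsum (fpf_inv z) (fun _ => 1%nat)).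
  { apply fsum_ext; [|auto]. intros [x y]. unfold invs, fpf_inv. cbn [fst snd].
    split; [tauto|]. intros (H1 & H2 & H3). repeat split; auto.
    all: destruct (window_dec N x) as [Wx|Wx]; destruct (window_dec N y) as [Wy|Wy].
    all: try (pose proof (Sz x Wx)); try (pose proof (Sz y Wy));
      try (pose proof (supp_window N z x F Sz Wx)); try (pose proof (supp_window N z y F Sz Wy));
      destruct (Theta_spec x); destruct (Theta_spec y); unfold window in *; lia. }
  rewrite E1.
  assert (FW : finite (window N)).
  { destruct (fin_Zint (1 - 2 * N) (2 * N)) as [l Hl]. now apply (fin_incl _ l). }
  rewrite (fsum_split (window N) (fun x => x < z x)) by auto.
  set (A := fun p => invs (window N) z p /\ z (fst p) = snd p).
  assert (E2 : fsum (fun x => window N x /\ x < z x) (fun _ => 1%nat) = fsum A (fun _ => 1%nat)).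
  { apply (fsum_bij A _ fst (fun x => (x, z x)) (fun _ => 1%nat)).
    - intros [x y] [(H1 & H2 & H3 & H4) H5]; cbn [fst snd] in *. subst y. auto.
    - intros x [H1 H2]. split; auto. split; auto. unfold invs; cbn [fst snd]. rewrite I.
      pose proof (supp_window N z x F Sz H1). split; [|split; [|split]]; auto; lia. }
  assert (E3 : fsum (fun x => window N x /\ ~ x < z x) (fun _ => 1%nat) = fsum A (fun _ => 1%nat)).
  { apply (fsum_bij A _ snd (fun x => (z x, x)) (fun _ => 1%nat)).
    - intros [x y] [(H1 & H2 & H3 & H4) H5]; cbn [fst snd] in *. subst y.
      rewrite I in *. split; [split; [auto|lia]|reflexivity].
    - intros x [H1 H2]. pose proof (NF x). split; auto. split; [|apply I].
      unfold invs; cbn [fst snd]. rewrite I.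
      pose proof (supp_window N z x F Sz H1). split; [|split; [|split]]; auto; lia. }
  rewrite E2, E3. lia.
Qed.

Lemma FZ_supp_window y a b : in_FZ y -> exists N, supp N y /\ window N a /\ window N b.
Proof.
  intros H. destruct (FZ_supp y H) as (N & H0 & HN).
  exists (N + Z.abs a + Z.abs b + 1). split; [eapply supp_mono; [|eauto]; lia|unfold window; lia].
Qed.

Lemma ellhatE z : ellhat_FPF z = (ncard (fpf_inv z) / 2)%nat.
Proof. reflexivity. Qed.

(** Conjugation multiplies by [s_i] on both sides. Each multiplication adds one inversion, and the
    passage from right to left is free because [y s_i] and [s_i y] are inverse to each other. *)
Lemma ellhat_asc y i : in_FZ y -> y i < y (i + 1) ->
  ellhat_FPF (tconj i (i + 1) y) = S (ellhat_FPF y).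
Proof.
  intros H A. pose proof (FZ_fpf y H) as F. destruct (FZ_supp_window y i (i + 1) H) as (N & S & W1 & W2).
  pose proof (supp_tconj N i (i + 1) y F S W1 W2) as S'.
  pose proof (inv_fpf_inv N _ F S) as E.
  pose proof (inv_fpf_inv N _ (fpf_tconj i (i+1) y F) S') as E'.
  pose proof (proj1 F) as I. pose proof (proj2 F) as NF.
  assert (A1 : ncard (invs (window N) (fun x => y (s_ i x))) = Datatypes.S (ncard (invs (window N) y))).
  { apply inv_asc; auto. apply fin_invs_window. }
  assert (A2 : ncard (invs (window N) (fun x => s_ i (y x))) = ncard (invs (window N) (fun x => y (s_ i x)))).
  { assert (Ds : forall x, window N x -> window N (s_ i x)) by (intros; transp_cases; auto).
    apply inv_inverse; intros; rewrite ?s_invol, ?I, ?s_invol; auto.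
    - apply supp_window; auto.
    - apply Ds, supp_window; auto. }
  assert (A3 : ncard (invs (window N) (tconj i (i + 1) y)) = Datatypes.S (ncard (invs (window N) (fun x => s_ i (y x))))).
  { apply (inv_asc (window N) (fun x => s_ i (y x))); auto. apply fin_invs_window.
    apply s_lt; auto. intros [E1 _]. now apply (NF i). }
  rewrite !ellhatE.
  (* The count grows by exactly two, so the floor of its half grows by one whatever its parity. *)
  replace (ncard (fpf_inv (tconj i (i + 1) y))) with (1 * 2 + ncard (fpf_inv y))%nat by lia.
  rewrite Nat.div_add_l; lia.
Qed.

(** As in [ellhat_asc], both multiplications raise the number of inversions; [y a <> b] ensures that
    the first one leaves the values [y a] and [y b] in place for the second. *)
Lemma ellhat_lt y a b : in_FZ y -> a < b -> y a < y b -> y a <> b ->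
  (ellhat_FPF y < ellhat_FPF (tconj a b y))%nat.
Proof.
  intros H L A NP. pose proof (FZ_fpf y H) as F. destruct (FZ_supp_window y a b H) as (N & S & W1 & W2).
  pose proof (supp_tconj N a b y F S W1 W2) as S'.
  pose proof (inv_fpf_inv N _ F S) as E.
  pose proof (inv_fpf_inv N _ (fpf_tconj a b y F) S') as E'.
  pose proof (fpf_inj y F) as J. pose proof (proj1 F) as I. pose proof (proj2 F) as NF.
  assert (A1 : (ncard (invs (window N) y) < ncard (invs (window N) (fun x => y (transp a b x))))%nat).
  { apply inv_transp_lt; auto; unfold window in *; lia. }
  assert (A2 : ncard (invs (window N) (fun x => transp a b (y x))) = ncard (invs (window N) (fun x => y (transp a b x)))).
  { assert (Ds : forall x, window N x -> window N (transp a b x)) by (intros; transp_cases; auto).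
    apply inv_inverse; intros; rewrite ?transp_invol, ?I, ?transp_invol; auto.
    - apply supp_window; auto.
    - apply Ds, supp_window; auto. }
  assert (A3 : (ncard (invs (window N) (fun x => transp a b (y x))) < ncard (invs (window N) (tconj a b y)))%nat).
  { apply (inv_transp_lt (1 - 2 * N) (2 * N) (fun x => transp a b (y x))); auto; try (unfold window in *; lia).
    - intros u v Huv. apply transp_inj in Huv. auto.
    - rewrite !transp_other; auto. intros Eb. apply NP. rewrite <- Eb. apply I. }
  rewrite !ellhatE.
  apply Nat.lt_le_trans with ((1 * 2 + ncard (fpf_inv y)) / 2)%nat.
  - rewrite Nat.div_add_l; lia.
  - apply Nat.Div0.div_le_mono. lia.
Qed.

Lemma ellhat_Theta : ellhat_FPF Theta = 0%nat.
Proof.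
  unfold ellhat_FPF, ncard. rewrite (fsum_ext _ (fun _ => False) _ (fun _ => 1%nat)).
  - now rewrite fsum_0.
  - intros [x y]; cbn [fst snd]. split; [|easy].
    destruct (Theta_spec x); destruct (Theta_spec y); lia.
  - auto.
Qed.

(** * Covers *)

Notation cj i := (tconj i (i + 1)).

Definition desc (z : Z -> Z) (i : Z) : Prop := z (i + 1) < z i /\ z i <> i + 1.

Lemma cjE i z x : cj i z x = s_ i (z (s_ i x)).
Proof. reflexivity. Qed.

Lemma trichotomy z i : fpf z -> z i < z (i + 1) \/ z i = i + 1 \/ desc z i.
Proof.
  intros F. destruct (Z.lt_trichotomy (z i) (z (i + 1))) as [|[E|]]; auto.
  - apply fpf_inj in E; auto; lia.
  - unfold desc. destruct (Z.eq_dec (z i) (i + 1)); auto.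
Qed.

Lemma cj_pair i z : fpf z -> z i = i + 1 -> cj i z = z.
Proof.
  intros [I NF] E. apply functional_extensionality; intros x. rewrite cjE.
  assert (E' : z (i + 1) = i) by (rewrite <- E; apply I).
  unfold s_, transp. destruct (Z.eqb_spec x i) as [->|N1].
  - rewrite E'. transp_cases.
  - destruct (Z.eqb_spec x (i + 1)) as [->|N2].
    + rewrite E. transp_cases.
    + destruct (Z.eqb_spec (z x) i) as [E1|_].
      { elim N2. rewrite <- (I x), E1. auto. }
      destruct (Z.eqb_spec (z x) (i + 1)) as [E1|_]; auto.
      elim N1. rewrite <- (I x), E1. auto.
Qed.

Lemma desc_cj i z : fpf z -> z i < z (i + 1) -> desc (cj i z) i.
Proof.
  intros [I NF] A. unfold desc. rewrite !cjE.
  replace (s_ i i) with (i + 1) by transp_cases. replace (s_ i (i + 1)) with i by transp_cases.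
  split.
  - apply s_lt; auto. intros [E _]. now apply (NF i).
  - intros E. assert (E1 : z (i + 1) = i) by transp_cases.
    assert (z i = i + 1) by (rewrite <- E1 at 1; apply I). lia.
Qed.

Lemma asc_cj i z : fpf z -> desc z i -> cj i z i < cj i z (i + 1).
Proof.
  intros [I NF] [A B]. rewrite !cjE.
  replace (s_ i i) with (i + 1) by transp_cases. replace (s_ i (i + 1)) with i by transp_cases.
  apply s_lt; auto. intros [E1 E]. auto.
Qed.

Lemma ellhat_desc z i : in_FZ z -> desc z i -> ellhat_FPF z = S (ellhat_FPF (cj i z)).
Proof.
  intros H A. rewrite <- (tconj_invol i (i + 1) z) at 1. apply ellhat_asc.
  - now apply FZ_tconj.
  - apply asc_cj; auto using FZ_fpf.
Qed.

Lemma s_transp i a b x : s_ i (transp a b (s_ i x)) = transp (s_ i a) (s_ i b) x.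
Proof. transp_cases. Qed.

Lemma cj_tconj i a b y : cj i (tconj a b y) = tconj (s_ i a) (s_ i b) (cj i y).
Proof.
  apply functional_extensionality; intros x. rewrite cjE. unfold tconj at 1 2.
  rewrite cjE, <- !s_transp, !s_invol. reflexivity.
Qed.

(** Put [t = (a, b)] and [t' = y t y = (y a, y b)]. They commute, since [y a <> b] makes them
    disjoint, so [t' y t' = y t t' = y t' t = t y t]. *)
Lemma tconj_images y a b : fpf y -> y a <> b -> tconj (y a) (y b) y = tconj a b y.
Proof.
  intros [I NF] N. apply functional_extensionality; intros x. unfold tconj.
  pose proof (I a); pose proof (I b); pose proof (I x);
  pose proof (NF a); pose proof (NF b); pose proof (NF x).
  unfold transp; destruct (Z.eqb_spec x a), (Z.eqb_spec x b), (Z.eqb_spec x (y a)), (Z.eqb_spec x (y b));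
  repeat match goal with |- context [?a =? ?b] => destruct (Z.eqb_spec a b) end; congruence.
Qed.

(** If [y b < y a], then [ellhat_lt] applied to the conjugate makes [y] the longer of the two; if
    [y a = b], conjugation changes nothing. *)
Lemma tconj_up y a b : in_FZ y -> a < b ->
  (ellhat_FPF y < ellhat_FPF (tconj a b y))%nat -> y a < y b /\ y a <> b.
Proof.
  intros H L strip. pose proof (FZ_fpf y H) as F. pose proof F as [I NF].
  destruct (Z.eq_dec (y a) b) as [E|E].
  { exfalso. assert (E' : y b = a) by (rewrite <- E; apply I).
    assert (tconj a b y = y); [|rewrite H0 in strip; lia].
    apply functional_extensionality; intros x. unfold tconj.
    assert (a <> b) by lia. pose proof (I x); pose proof (NF x).
    unfold transp; destruct (Z.eqb_spec x a); [|destruct (Z.eqb_spec x b)];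
    repeat match goal with |- context [?a =? ?b] => destruct (Z.eqb_spec a b) end; congruence. }
  split; auto. destruct (Z.lt_trichotomy (y a) (y b)) as [|[E1|G]]; auto; exfalso.
  { apply fpf_inj in E1; auto; lia. }
  assert (Nb : y b <> a) by (intros <-; auto).
  assert (Va : tconj a b y a = y b).
  { unfold tconj. rewrite transp_l. apply transp_other; auto. }
  assert (Vb : tconj a b y b = y a).
  { unfold tconj. rewrite transp_r. apply transp_other; auto. }
  pose proof (ellhat_lt (tconj a b y) a b (FZ_tconj a b y H) L) as Lt.
  rewrite Va, Vb, tconj_invol in Lt. specialize (Lt G (NF b)). lia.
Qed.

(* Conjugation by [s_i] keeps the order of [a < b] and of [y a < y b] unless one of these
   pairs is [(i, i + 1)], and in both cases [tconj a b y = cj i y]. *)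
Lemma cover_cj_lt y a b i : in_FZ y -> a < b ->
  (ellhat_FPF y < ellhat_FPF (tconj a b y))%nat -> tconj a b y <> cj i y ->
  (ellhat_FPF (cj i y) < ellhat_FPF (cj i (tconj a b y)))%nat.
Proof.
  intros H L strip N. destruct (tconj_up y a b H L strip) as [A B].
  pose proof (FZ_fpf y H) as F. rewrite cj_tconj. apply ellhat_lt.
  - now apply FZ_tconj.
  - apply s_lt; auto. intros [-> ->]. now apply N.
  - rewrite !cjE, !s_invol. apply s_lt; auto. intros [E1 E2]. apply N.
    rewrite <- (tconj_images y a b); auto. now rewrite E1, E2.
  - rewrite cjE, s_invol. intros E. apply (f_equal (s_ i)) in E. now rewrite !s_invol in E.
Qed.

Lemma cover_cj y a b i : in_FZ y -> a <> b ->
  (ellhat_FPF y < ellhat_FPF (tconj a b y))%nat -> tconj a b y <> cj i y ->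
  (ellhat_FPF (cj i y) < ellhat_FPF (cj i (tconj a b y)))%nat.
Proof.
  intros H N. destruct (Z.lt_trichotomy a b) as [|[|]]; [|easy|rewrite tconj_sym];
  apply cover_cj_lt; auto.
Qed.

(** By [cover_cj], conjugating the cover by [s_i] gives more than [ellhat_FPF y + 1], the length of
    the cover itself. A descent would lower that length and a cycle [(i, i + 1)] would keep it. *)
Lemma cover_asc y a b i : in_FZ y -> a <> b -> y i < y (i + 1) ->
  ellhat_FPF (tconj a b y) = (ellhat_FPF y + 1)%nat -> tconj a b y <> cj i y ->
  tconj a b y i < tconj a b y (i + 1).
Proof.
  intros H L A E N. pose proof (cover_cj y a b i H L ltac:(lia) N) as C.
  rewrite (ellhat_asc y i H A) in C. pose proof (FZ_tconj a b y H) as H'.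
  destruct (trichotomy (tconj a b y) i (FZ_fpf _ H')) as [|[P|D]]; auto; exfalso.
  - rewrite cj_pair in C; auto using FZ_fpf. lia.
  - rewrite (ellhat_desc _ i H' D) in E. lia.
Qed.

(** Here [cj i y = y], so stripping a descent [i] from the cover would leave length [ellhat_FPF y],
    against the strict inequality of [cover_cj]. *)
Lemma cover_pair y a b i : in_FZ y -> a <> b -> y i = i + 1 ->
  ellhat_FPF (tconj a b y) = (ellhat_FPF y + 1)%nat -> ~ desc (tconj a b y) i.
Proof.
  intros H L A E D. pose proof (cover_cj y a b i H L ltac:(lia)) as C.
  rewrite (cj_pair i y) in C; auto using FZ_fpf.
  rewrite (ellhat_desc _ i (FZ_tconj a b y H) D) in E.
  assert (tconj a b y <> y) as N; [|specialize (C N); lia].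
  intros E1. rewrite <- (ellhat_desc _ i (FZ_tconj a b y H) D), E1 in E. lia.
Qed.

(** * Stripping a letter from the sets of covers *)

Definition Psi (D : Z -> Z -> Prop) (y : Z -> Z) (r : Z) (z : Z -> Z) : Prop :=
  in_FZ z /\ ellhat_FPF z = (ellhat_FPF y + 1)%nat /\ exists j, D r j /\ z = tconj r j y.

(** [Z.lt] gives the covers above [r], that is [PsiPlus], and [Z.gt] those below it, [PsiMinus]; the
    stripping lemmas are thus proved once for both. *)
Definition side (D : Z -> Z -> Prop) : Prop := D = Z.lt \/ D = Z.gt.

Lemma side_s D i r j : side D -> D r j -> ~ (r = i /\ j = i + 1) -> ~ (r = i + 1 /\ j = i) ->
  D (s_ i r) (s_ i j).
Proof. intros [-> | ->]; transp_cases. Qed.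

Lemma side_ne D r j : side D -> D r j -> r <> j.
Proof. intros [-> | ->]; lia. Qed.

(** The functional [g] composed with the operator [u_i], where [g] takes the value 0 at 0. *)
Definition strip (i : Z) (g : (Z -> Z) -> nat) (z : Z -> Z) : nat :=
  if excluded_middle_informative (desc z i) then g (cj i z) else 0%nat.

Definition iverson (P : Prop) (n : nat) : nat := if excluded_middle_informative P then n else 0%nat.

Lemma iverson_1 (P : Prop) n : P -> iverson P n = n.
Proof. unfold iverson. destruct excluded_middle_informative; tauto. Qed.

Lemma iverson_0 (P : Prop) n : ~ P -> iverson P n = 0%nat.
Proof. unfold iverson. destruct excluded_middle_informative; tauto. Qed.

Lemma fsum_strip {P : (Z -> Z) -> Prop} i g : finite P ->
  fsum P (strip i g) = fsum (fun z => P z /\ desc z i) (fun z => g (cj i z)).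
Proof.
  intros F. rewrite (fsum_restrict P (fun z => desc z i)); auto.
  - apply fsum_ext; [tauto|]. intros z [_ Hz]. unfold strip.
    destruct excluded_middle_informative; tauto.
  - intros z _ Hz. unfold strip. destruct excluded_middle_informative; tauto.
Qed.

Lemma Psi_desc D y r i g : side D -> in_FZ y -> desc y i ->
  finite (Psi D y r) -> finite (Psi D (cj i y) (s_ i r)) ->
  (fsum (Psi D y r) (strip i g) + iverson (Psi D (cj i y) (s_ i r) y) (g y)
   = fsum (Psi D (cj i y) (s_ i r)) g)%nat.
Proof.
  intros SD H Dy F F'. pose proof (FZ_fpf y H) as Fy.
  pose proof (FZ_tconj i (i + 1) y H) as H'. pose proof (ellhat_desc y i H Dy) as Ey.
  pose proof (asc_cj i y Fy Dy) as Ay'.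
  assert (E : fsum (Psi D y r) (strip i g)
              = fsum (fun z => Psi D (cj i y) (s_ i r) z /\ z <> y) g).
  { rewrite fsum_strip by auto. symmetry.
    apply (fsum_bij _ _ (tconj i (i + 1)) (tconj i (i + 1)) g).
    - intros z [(Hz & Ez & j & Dj & Cz) Dz]. rewrite tconj_invol. split; auto.
      pose proof (ellhat_desc z i Hz Dz) as Ez'.
      assert (Nz : cj i z <> y).
      { intros E. rewrite <- E, tconj_invol in Ey. rewrite <- E in Ez. lia. }
      split; auto. split; [now apply FZ_tconj|]. split; [lia|].
      exists (s_ i j). rewrite Cz, cj_tconj. split; auto.
      apply side_s; auto; intros [-> ->]; subst z; apply Nz.
      + apply tconj_invol. + rewrite (tconj_sym (i + 1)). apply tconj_invol.
    - intros z [(Hz & Ez & j & Dj & Cz) Nz]. rewrite tconj_invol. split; auto.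
      assert (Az : z i < z (i + 1)).
      { subst z. apply cover_asc; auto. eapply side_ne; eauto. now rewrite tconj_invol. }
      split; [|apply desc_cj; auto using FZ_fpf].
      split; [now apply FZ_tconj|]. split.
      { rewrite (ellhat_asc z i Hz Az). lia. }
      exists (s_ i j). split.
      + rewrite <- (s_invol i r). apply side_s; auto; intros [E1 ->];
        rewrite E1 in Cz; apply Nz; rewrite Cz.
        * apply tconj_invol. * rewrite tconj_sym. apply tconj_invol.
      + rewrite Cz, cj_tconj, s_invol, tconj_invol. reflexivity. }
  rewrite E. destruct (classic (Psi D (cj i y) (s_ i r) y)) as [P|P].
  - rewrite iverson_1 by auto. rewrite (fsum_remove _ _ y F' P). lia.
  - rewrite iverson_0 by auto. rewrite Nat.add_0_r. apply fsum_ext; auto.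
    intros z; split; [tauto|]. intros Hz; split; auto. now intros ->.
Qed.

(** By [cover_asc], only [cj i y] can be a cover that descends at [i], and stripping [i] from it
    returns [y]. *)
Lemma Psi_asc D y r i g : side D -> in_FZ y -> y i < y (i + 1) -> finite (Psi D y r) ->
  fsum (Psi D y r) (strip i g) = iverson (Psi D y r (cj i y)) (g y).
Proof.
  intros SD H A F. rewrite fsum_strip by auto.
  assert (X : forall z, Psi D y r z /\ desc z i -> z = cj i y).
  { intros z [(Hz & Ez & j & Dj & ->) Dz]. apply NNPP. intros N.
    apply cover_asc in N; auto. destruct Dz; lia. eapply side_ne; eauto. }
  destruct (classic (Psi D y r (cj i y))) as [P|P].
  - rewrite iverson_1 by auto. rewrite (fsum_sing _ _ (cj i y)); [now rewrite tconj_invol|].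
    intros z; split; auto. intros ->. split; auto. apply desc_cj; auto using FZ_fpf.
  - rewrite iverson_0 by auto. rewrite (fsum_ext _ (fun _ => False) _ (fun _ => 0%nat)).
    + now apply fsum_0.
    + intros z; split; [|easy]. intros Hz. pose proof (X z Hz). subst. tauto.
    + intros z Hz. pose proof (X z Hz). subst. tauto.
Qed.

Lemma Psi_pair D y r i g : side D -> in_FZ y -> y i = i + 1 -> fsum (Psi D y r) (strip i g) = 0%nat.
Proof.
  intros SD H A. apply fsum_0. intros z (Hz & Ez & j & Dj & ->).
  unfold strip. destruct excluded_middle_informative as [C|]; auto.
  exfalso. revert C. apply cover_pair; auto. eapply side_ne; eauto.
Qed.

(** A cover in this set sends [p] to some [j > q]. Among the conjugates by [s_i] at an ascent, this
    happens only if [s_i] moves [p] up or moves its partner [q] up. *)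
Lemma Psi_lt_cj y p q i : in_FZ y -> y p = q -> p < q -> y i < y (i + 1) ->
  (Psi Z.lt y q (cj i y) <-> i = p \/ i = q).
Proof.
  intros H Ep L A. pose proof (FZ_fpf y H) as F. pose proof F as [I NF].
  assert (Eq : y q = p) by (rewrite <- Ep; apply I).
  assert (Ni : y i <> i + 1) by (intros E; rewrite <- E, I in A; lia). split.
  - intros (_ & _ & j & Dj & E). pose proof (f_equal (fun f => f p) E) as V. cbv beta in V.
    rewrite cjE in V. unfold tconj in V. rewrite (transp_other q j p), Ep, transp_l in V by lia.
    apply NNPP; intros N.
    destruct (Z.eq_dec p (i + 1)) as [->|N1].
    { replace (s_ i (i + 1)) with i in V by transp_cases. assert (y i = j) by transp_cases. lia. }
    replace (s_ i p) with p in V by transp_cases. rewrite Ep in V. transp_cases.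
  - intros C. split; [now apply FZ_tconj|]. split; [rewrite (ellhat_asc y i H A); lia|].
    destruct C as [->| ->].
    (* By [tconj_images], conjugation by [(p, p + 1)] is conjugation by [(q, y (p + 1))], and
       [y (p + 1) > y p = q]. *)
    + exists (y (p + 1)). split; [lia|]. rewrite <- Ep. symmetry. now apply tconj_images.
    + exists (q + 1). split; [lia|auto].
Qed.

Lemma Psi_gt_cj y p q i : in_FZ y -> y p = q -> p < q -> y i < y (i + 1) ->
  (Psi Z.gt y p (cj i y) <-> i + 1 = p \/ i + 1 = q).
Proof.
  intros H Ep L A. pose proof (FZ_fpf y H) as F. pose proof F as [I NF].
  assert (Eq : y q = p) by (rewrite <- Ep; apply I).
  assert (Ni : y i <> i + 1) by (intros E; rewrite <- E, I in A; lia). split.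
  - intros (_ & _ & j & Dj & E). pose proof (f_equal (fun f => f q) E) as V. cbv beta in V.
    rewrite cjE in V. unfold tconj in V. rewrite (transp_other p j q), Eq, transp_l in V by lia.
    apply NNPP; intros N.
    destruct (Z.eq_dec q i) as [->|N1].
    { replace (s_ i i) with (i + 1) in V by transp_cases. assert (y (i + 1) = j) by transp_cases. lia. }
    replace (s_ i q) with q in V by transp_cases. rewrite Eq in V. transp_cases.
  - intros C. split; [now apply FZ_tconj|]. split; [rewrite (ellhat_asc y i H A); lia|].
    destruct C as [<-|E].
    + exists i. split; [lia|]. now rewrite tconj_sym.
    + exists (y i). rewrite E in A. split; [lia|].
      rewrite (tconj_sym p), <- Eq, <- E. symmetry.
      now apply tconj_images.
Qed.

(** If [j] lay beyond the larger window, a whole cycle of [Theta] outside [window N] would separate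
    it from [q]. With [i] the last point of the cycle just before that of [j], [y] ascends at [i],
    whereas the conjugate sends [i + 1] to [p] or [q] and so descends there, against [cover_asc]. *)
Lemma Psi_lt_bound N y p q z : in_FZ y -> supp N y -> window N p -> window N q -> y p = q -> p < q ->
  Psi Z.lt y q z -> exists j, window (N + 1) j /\ z = tconj q j y.
Proof.
  intros H S Wp Wq Ep L (Hz & Ez & j & Dj & ->). exists j. split; auto.
  pose proof (FZ_fpf y H) as F. pose proof F as [I NF].
  assert (Eq : y q = p) by (rewrite <- Ep; apply I).
  apply NNPP; intros W. unfold window in *.
  destruct (Theta_spec j) as [k Hk].
  assert (Y : forall l, l > N -> y (2 * l) = 2 * l - 1 /\ y (2 * l - 1) = 2 * l).
  { intros l Hl. split; rewrite S by (unfold window; lia); [destruct (Theta_spec (2 * l))|destruct (Theta_spec (2 * l - 1))]; lia. }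
  destruct (Y (k - 1)) as [Y1 _]; [lia|]. destruct (Y k) as [Y2 Y3]; [lia|].
  remember (2 * (k - 1)) as i eqn:Ei. replace (2 * k - 1) with (i + 1) in * by lia.
  assert (C : tconj q j y i < tconj q j y (i + 1)).
  { apply cover_asc; auto; [lia|lia|]. intros E.
    apply (f_equal (fun f => f p)) in E. unfold tconj in E at 1.
    rewrite (transp_other q j p), Ep, transp_l in E by lia.
    unfold tconj in E.
    rewrite (transp_other i (i + 1) p), Ep, (transp_other i (i + 1) q) in E by lia. lia. }
  unfold tconj in C. rewrite (transp_other q j i), Y1, (transp_other q j (i - 1)) in C by lia.
  destruct Hk as [[-> _]|[-> _]].
  - rewrite (transp_other _ _ (i + 1)), Y3, transp_r in C by lia. lia.
  - rewrite transp_r, Eq, transp_other in C by lia. lia.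
Qed.

(** Mirror image of [Psi_lt_bound]: [i] is the last point of the cycle of [j], and the next cycle
    still lies below [window N]. *)
Lemma Psi_gt_bound N y p q z : in_FZ y -> supp N y -> window N p -> window N q -> y p = q -> p < q ->
  Psi Z.gt y p z -> exists j, window (N + 1) j /\ z = tconj p j y.
Proof.
  intros H S Wp Wq Ep L (Hz & Ez & j & Dj & ->). exists j. split; auto.
  pose proof (FZ_fpf y H) as F. pose proof F as [I NF].
  assert (Eq : y q = p) by (rewrite <- Ep; apply I).
  apply NNPP; intros W. unfold window in *.
  destruct (Theta_spec j) as [k Hk].
  assert (Y : forall l, l <= - N -> y (2 * l) = 2 * l - 1 /\ y (2 * l - 1) = 2 * l).
  { intros l Hl. split; rewrite S by (unfold window; lia); [destruct (Theta_spec (2 * l))|destruct (Theta_spec (2 * l - 1))]; lia. }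
  destruct (Y (k + 1)) as [_ Y1]; [lia|]. destruct (Y k) as [Y2 Y3]; [lia|].
  remember (2 * k) as i eqn:Ei. replace (2 * (k + 1) - 1) with (i + 1) in * by lia.
  replace (2 * (k + 1)) with (i + 2) in * by lia.
  assert (C : tconj p j y i < tconj p j y (i + 1)).
  { apply cover_asc; auto; [lia|lia|]. intros E.
    apply (f_equal (fun f => f q)) in E. unfold tconj in E at 1.
    rewrite (transp_other p j q), Eq, transp_l in E by lia.
    unfold tconj in E.
    rewrite (transp_other i (i + 1) q), Eq, (transp_other i (i + 1) p) in E by lia. lia. }
  unfold tconj in C. rewrite (transp_other p j (i + 1)), Y1, (transp_other p j (i + 2)) in C by lia.
  destruct Hk as [[-> _]|[-> _]].
  - rewrite transp_r, Ep, transp_other in C by lia. lia.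
  - rewrite (transp_other _ _ i), Y2, transp_r in C by lia. lia.
Qed.

(** * Words of atoms *)

(* Reversed words: the head of [a] is the last letter, the one stripped first from [z]. *)
Fixpoint valid (a : list Z) (z : Z -> Z) : Prop :=
  match a with
  | [] => z = Theta
  | b :: a' => desc z b /\ valid a' (cj b z)
  end.

Lemma word_perm_rcons a b x : word_perm (a ++ [b]) x = word_perm a (s_ b x).
Proof. induction a as [|c a IH]; simpl; [reflexivity|]. now rewrite IH. Qed.

Lemma in_SZ_id : in_SZ (fun x => x).
Proof. split; [now exists (fun x => x)|now exists 0]. Qed.

Lemma in_SZ_word a : in_SZ (word_perm a).
Proof.
  induction a as [|b a IH] using rev_ind; [apply in_SZ_id|].
  replace (word_perm (a ++ [b])) with (fun x => word_perm a (transp b (b + 1) x)).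
  - now apply in_SZ_transp.
  - apply functional_extensionality; intros x. symmetry. apply word_perm_rcons.
Qed.

Lemma twisted_FZ a z : twisted (word_perm a) z -> in_FZ z.
Proof. exists (word_perm a). split; auto using in_SZ_word. Qed.

Lemma twisted_rcons a b z :
  twisted (word_perm (a ++ [b])) z <-> twisted (word_perm a) (cj b z).
Proof.
  split; intros T x.
  - specialize (T (s_ b x)). rewrite !word_perm_rcons in T. now rewrite s_invol in T.
  - specialize (T (s_ b x)). rewrite !word_perm_rcons. rewrite cjE, s_invol in T. exact T.
Qed.

Lemma twisted_id z : twisted (word_perm []) z <-> z = Theta.
Proof.
  split; [|intros ->; now intros x]. intros T. apply functional_extensionality. exact T.
Qed.

(** Removing a letter lowers [ellhat_FPF] by at most one, in each case of [trichotomy]. *)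
Lemma ellhat_le_length a z : twisted (word_perm a) z -> (ellhat_FPF z <= length a)%nat.
Proof.
  revert z. induction a as [|b a IH] using rev_ind; intros z T.
  - apply twisted_id in T. subst. now rewrite ellhat_Theta.
  - pose proof (twisted_FZ _ _ T) as H. apply twisted_rcons in T. apply IH in T.
    rewrite length_app; simpl.
    destruct (trichotomy z b (FZ_fpf z H)) as [A|[A|A]].
    + rewrite (ellhat_asc z b H A) in T. lia.
    + rewrite cj_pair in T; auto using FZ_fpf. lia.
    + rewrite (ellhat_desc z b H A). lia.
Qed.

Lemma valid_twisted a z : valid (rev a) z -> length a = ellhat_FPF z /\ twisted (word_perm a) z.
Proof.
  revert z. induction a as [|b a IH] using rev_ind; intros z V.
  - simpl in V. subst. rewrite ellhat_Theta. split; auto. now apply twisted_id.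
  - rewrite rev_app_distr in V. destruct V as [D V]. apply IH in V. destruct V as [L T].
    apply twisted_rcons in T. split; auto.
    rewrite length_app, (ellhat_desc z b (twisted_FZ _ _ T) D); simpl; lia.
Qed.

(** A word of this length has no letter to spare: by [ellhat_le_length], each letter removed must
    lower the length, hence be a descent. *)
Lemma twisted_valid a z : length a = ellhat_FPF z -> twisted (word_perm a) z -> valid (rev a) z.
Proof.
  revert z. induction a as [|b a IH] using rev_ind; intros z L T.
  - now apply twisted_id.
  - pose proof (twisted_FZ _ _ T) as H. apply twisted_rcons in T.
    pose proof (ellhat_le_length _ _ T) as L'. rewrite length_app in L; simpl in L.
    rewrite rev_app_distr; simpl.
    destruct (trichotomy z b (FZ_fpf z H)) as [A|[A|A]].
    + rewrite (ellhat_asc z b H A) in L'. lia.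
    + rewrite cj_pair in L'; auto using FZ_fpf. lia.
    + split; auto. apply IH; auto. rewrite (ellhat_desc z b H A) in L. lia.
Qed.

Lemma valid_FZ a z : valid a z -> in_FZ z.
Proof.
  intros V. rewrite <- (rev_involutive a) in V. apply valid_twisted in V.
  now apply (twisted_FZ (rev a)).
Qed.

Lemma valid_length a z : valid a z -> length a = ellhat_FPF z.
Proof.
  intros V. rewrite <- (rev_involutive a) in V. apply valid_twisted in V.
  now rewrite length_rev in V.
Qed.

(** The cycles [{2 k - 1, 2 k}] are recovered from left to right. The partner of [2 k - 1] cannot
    lie further left, where all points are already paired, so it must be shown not to exceed
    [2 k]. *)
Lemma no_desc_Theta z : in_FZ z -> (forall i, ~ desc z i) -> z = Theta.
Proof.
  intros H ND. pose proof (FZ_fpf z H) as F. pose proof F as [I NF].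
  destruct (FZ_supp z H) as (N & N0 & S).
  assert (G : forall n k, k = Z.of_nat n - N -> forall x, x <= 2 * k -> z x = Theta x).
  2:{ apply functional_extensionality; intros x.
      apply (G (Z.to_nat (Z.abs x + N)) (Z.abs x + N - N)); lia. }
  induction n as [|n IH]; intros k Hk x Hx.
  { apply S. unfold window. lia. }
  specialize (IH (k - 1) ltac:(lia)).
  assert (E : z (2 * k - 1) = 2 * k).
  { destruct (Z.lt_trichotomy (z (2 * k - 1)) (2 * k)) as [L|[L|L]]; auto; exfalso.
    - destruct (Z.eq_dec (z (2 * k - 1)) (2 * k - 1)) as [E|E]; [now apply NF in E|].
      pose proof (IH (z (2 * k - 1)) ltac:(lia)) as E1. rewrite I in E1.
      destruct (Theta_spec (z (2 * k - 1))); lia.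
    - set (m := z (2 * k - 1)) in *.
      (* Without descents, the values of [z] stay at least [m] from [2 k - 1] up to [m], but
         [z m = 2 k - 1]. A step with [z i = i + 1] would force [i + 1 = m], hence [i = 2 k - 1] and
         [m = 2 k]. *)
      assert (C : forall n, 2 * k - 1 + Z.of_nat n <= m -> m <= z (2 * k - 1 + Z.of_nat n)).
      { clear n Hk IH. induction n as [|n IH]; intros Hn.
        - rewrite Z.add_0_r. unfold m; lia.
        - specialize (IH ltac:(lia)).
          set (i := 2 * k - 1 + Z.of_nat n) in *.
          replace (2 * k - 1 + Z.of_nat (Datatypes.S n)) with (i + 1) in * by lia.
          destruct (trichotomy z i F) as [A|[A|A]].
          + lia.
          + exfalso. assert (m = i + 1) by lia.
            assert (E : i = 2 * k - 1); [|lia].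
            apply (fpf_inj z F). rewrite A. fold m. lia.
          + now apply ND in A. }
      specialize (C (Z.to_nat (m - (2 * k - 1))) ltac:(lia)).
      rewrite Z2Nat.id in C by lia. replace (2 * k - 1 + (m - (2 * k - 1))) with m in C by lia.
      assert (z m = 2 * k - 1) by apply I. lia. }
  destruct (Z.eq_dec x (2 * k)) as [->|N1].
  { rewrite <- E, I. destruct (Theta_spec (z (2 * k - 1))). lia. }
  destruct (Z.eq_dec x (2 * k - 1)) as [->|N2].
  { rewrite E. destruct (Theta_spec (2 * k - 1)). lia. }
  apply IH. lia.
Qed.

Lemma valid_exists z : in_FZ z -> exists a, valid a z.
Proof.
  remember (ellhat_FPF z) as n eqn:E. revert z E. induction n as [|n IH]; intros z E H.
  all: destruct (classic (exists i, desc z i)) as [[i D]|ND].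
  - rewrite (ellhat_desc z i H D) in E. discriminate.
  - exists []. apply no_desc_Theta; auto. intros i D. apply ND; eauto.
  - destruct (IH (cj i z)) as [a V].
    + rewrite (ellhat_desc z i H D) in E. lia.
    + now apply FZ_tconj.
    + exists (i :: a). now split.
  - exists []. apply no_desc_Theta; auto. intros i D. apply ND; eauto.
Qed.

(** * Reduced words of permutations, and atoms *)

Lemma ell_invs w : ell w = ncard (invs (fun _ => True) w).
Proof. apply fsum_ext; auto. intros [x y]. unfold invs. cbn [fst snd]. tauto. Qed.

Lemma fin_invs_SZ w : in_SZ w -> finite (invs (fun _ => True) w).
Proof.
  intros H. pose proof (SZ_inj w H) as J. destruct H as [_ [N HN]].
  destruct (fin_Zint (- Z.abs N) (Z.abs N)) as [l Hl].
  assert (B : forall x, Z.abs N < Z.abs x \/ Z.abs (w x) <= Z.abs N).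
  { intros x. destruct (Z_lt_le_dec (Z.abs N) (Z.abs (w x))) as [G|]; auto.
    left. assert (E : w (w x) = w x) by (apply HN; lia). apply J in E. now rewrite E in G. }
  assert (HN' : forall x, Z.abs N < Z.abs x -> w x = x) by (intros; apply HN; lia).
  apply (fin_incl _ (list_prod l l)).
  intros [x y] (_ & _ & H3 & H4); cbn [fst snd] in *.
  pose proof (B x); pose proof (B y); pose proof (HN' x); pose proof (HN' y).
  apply in_prod; apply Hl; lia.
Qed.

Lemma ell_asc w i : in_SZ w -> w i < w (i + 1) -> ell (fun x => w (s_ i x)) = S (ell w).
Proof.
  intros H A. rewrite !ell_invs. apply inv_asc; auto.
  apply fin_invs_SZ. now apply in_SZ_transp.
Qed.

Lemma ell_desc w i : in_SZ w -> w (i + 1) < w i -> ell w = S (ell (fun x => w (s_ i x))).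
Proof. intros H A. rewrite !ell_invs. apply inv_desc; auto using fin_invs_SZ. Qed.

Lemma ell_id : ell (fun x => x) = 0%nat.
Proof.
  unfold ell, ncard. rewrite (fsum_ext _ (fun _ => False) _ (fun _ => 1%nat)).
  - now rewrite fsum_0.
  - intros [x y]; cbn [fst snd]. lia.
  - auto.
Qed.

Lemma ell_word_le a : (ell (word_perm a) <= length a)%nat.
Proof.
  induction a as [|b a IH] using rev_ind.
  - change (word_perm []) with (fun x : Z => x). now rewrite ell_id.
  - replace (word_perm (a ++ [b])) with (fun x => word_perm a (s_ b x)).
    2:{ apply functional_extensionality; intros x. symmetry. apply word_perm_rcons. }
    rewrite length_app; simpl. pose proof (in_SZ_word a) as H.
    destruct (Z.lt_trichotomy (word_perm a b) (word_perm a (b + 1))) as [A|[A|A]].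
    + rewrite ell_asc; auto. lia.
    + apply (SZ_inj _ H) in A. lia.
    + rewrite (ell_desc _ b) in IH; auto. lia.
Qed.

Lemma no_desc_id w : in_SZ w -> (forall i, w i < w (i + 1)) -> forall x, w x = x.
Proof.
  intros [_ [N HN]] A.
  assert (G : forall x n, w x + Z.of_nat n <= w (x + Z.of_nat n)).
  { intros x n. induction n as [|n IH].
    - rewrite !Z.add_0_r; lia.
    - pose proof (A (x + Z.of_nat n)) as B.
      replace (x + Z.of_nat n + 1) with (x + Z.of_nat (S n)) in B by lia. lia. }
  intros x. set (n := Z.to_nat (Z.abs N + Z.abs x + 1)).
  pose proof (G x n) as G1. pose proof (G (x - Z.of_nat n) n) as G2.
  rewrite Z.sub_add in G2. rewrite (HN (x + Z.of_nat n)) in G1 by lia.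
  rewrite (HN (x - Z.of_nat n)) in G2 by lia. lia.
Qed.

Lemma word_exists w : in_SZ w -> exists a, length a = ell w /\ w = word_perm a.
Proof.
  remember (ell w) as n eqn:E. revert w E. induction n as [|n IH]; intros w E H.
  all: destruct (classic (exists i, w (i + 1) < w i)) as [[i D]|ND].
  1: rewrite (ell_desc w i H D) in E; discriminate.
  2: { destruct (IH (fun x => w (s_ i x))) as (a & L & Ea).
       - rewrite (ell_desc w i H D) in E. lia.
       - now apply in_SZ_transp.
       - exists (a ++ [i]). rewrite length_app; simpl. split; [lia|].
         apply functional_extensionality; intros x. rewrite word_perm_rcons, <- Ea.
         now rewrite s_invol. }
  all: assert (W : w = fun x => x)
    by (apply functional_extensionality; apply no_desc_id; auto; intros i;
        destruct (Z.lt_trichotomy (w i) (w (i + 1))) as [|[B|B]]; auto;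
        [apply (SZ_inj w H) in B; lia|elim ND; eauto]).
  all: rewrite W, ell_id in E; try discriminate.
  exists []. auto.
Qed.

(** Every [v] with [twisted v z] has length at least [ellhat_FPF z], and a valid word attains this
    bound. So the atoms are the [v] of that length, and valid words are their reduced words
    reversed. *)
Lemma atom_reduced_word z w a : in_FZ z ->
  (A_FPF z w /\ reduced_word w a) <-> (valid (rev a) z /\ word_perm a = w).
Proof.
  intros H.
  assert (Lo : forall v, in_SZ v -> twisted v z -> (ellhat_FPF z <= ell v)%nat).
  { intros v Hv T. destruct (word_exists v Hv) as (b & <- & ->). now apply ellhat_le_length. }
  split.
  - intros [(Hw & T & M) [L E]].
    assert (Ew : w = word_perm a) by now apply functional_extensionality.
    split; auto. subst w. apply twisted_valid; auto.
    destruct (valid_exists z H) as [b V]. rewrite <- (rev_involutive b) in V.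
    apply valid_twisted in V. destruct V as [Lb Tb].
    specialize (M _ (in_SZ_word _) Tb). pose proof (ell_word_le (rev b)).
    pose proof (Lo _ Hw T). lia.
  - intros [V <-]. apply valid_twisted in V. destruct V as [L T].
    pose proof (Lo _ (in_SZ_word a) T). pose proof (ell_word_le a).
    split; [split; [apply in_SZ_word|split; auto]|split; auto].
    + intros v Hv Tv. specialize (Lo v Hv Tv). lia.
    + lia.
Qed.

Lemma desc_window N z b : fpf z -> supp N z -> desc z b -> window N b /\ window N (b + 1).
Proof.
  intros F Sz [D1 D2].
  destruct (window_dec N b) as [W1|W1]; destruct (window_dec N (b + 1)) as [W2|W2]; auto; exfalso.
  all: try (pose proof (Sz _ W1)); try (pose proof (Sz _ W2)).
  all: try (pose proof (supp_window N z _ F Sz W1)); try (pose proof (supp_window N z _ F Sz W2)).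
  all: destruct (Theta_spec b); destruct (Theta_spec (b + 1)); unfold window in *; lia.
Qed.

Lemma desc_supp N z b : fpf z -> supp N z -> desc z b -> supp N (cj b z).
Proof. intros F Sz D. destruct (desc_window N z b F Sz D). now apply supp_tconj. Qed.

Lemma valid_window N a z : fpf z -> supp N z -> valid a z -> forall c, In c a -> window N c.
Proof.
  revert z. induction a as [|b a IH]; intros z F Sz V c Hc; [easy|].
  destruct V as [D V]. destruct Hc as [<-|Hc].
  - now apply (desc_window N z).
  - apply (IH (cj b z)); auto using fpf_tconj. now apply desc_supp.
Qed.

Lemma fin_valid z : finite (fun a => valid a z).
Proof.
  destruct (classic (in_FZ z)) as [H|H].
  2:{ apply (fin_incl _ []). intros a V. elim H. now apply valid_FZ in V. }
  destruct (FZ_supp z H) as (N & _ & S).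
  apply (fin_sub _ _ (fin_words (1 - 2 * N) (2 * N) (ellhat_FPF z))).
  intros a V. split; [now apply valid_length|]. intros c.
  exact (valid_window N a z (FZ_fpf z H) S V c).
Qed.


(** * Words with labels *)

Fixpoint weakly_decr (ri : list nat) : Prop :=
  match ri with
  | [] => True
  | r :: ri' => match ri' with [] => True | r' :: _ => (r' <= r)%nat end /\ weakly_decr ri'
  end.

(** Both lists are reversed, so [c'] and [r'] precede [c] and [r] in the original word. The last
    case forces equal lengths. *)
Fixpoint label_steps (ra : list Z) (ri : list nat) : Prop :=
  match ra, ri with
  | [], [] => True
  | c :: ra', r :: ri' =>
      match ra', ri' with c' :: _, r' :: _ => c' < c -> (r' < r)%nat | _, _ => True end
      /\ label_steps ra' ri'
  | _, _ => False
  end.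

Lemma compatible_rcons a b i r : length a = length i ->
  compatible (a ++ [b]) (i ++ [r]) <->
  compatible a i /\ (1 <= r)%nat /\
  match rev a, rev i with c :: _, r' :: _ => (r' <= r)%nat /\ (c < b -> (r' < r)%nat) | _, _ => True end.
Proof.
  intros L. unfold compatible. rewrite !length_app; simpl. split.
  - intros (_ & P & Q). split; [split; [auto|split]|split].
    + intros j Hj. specialize (P j ltac:(lia)). now rewrite app_nth1 in P by lia.
    + intros j Hj. specialize (Q j ltac:(lia)). now rewrite !app_nth1 in Q by lia.
    + specialize (P (length i) ltac:(lia)). now rewrite nth_middle in P.
    + destruct a as [|c a _] using rev_ind; [easy|].
      destruct i as [|r' i _] using rev_ind; [now rewrite rev_app_distr|].
      rewrite !rev_app_distr; simpl. rewrite !length_app in *; simpl in *.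
      specialize (Q (length a) ltac:(lia)).
      rewrite <- !app_assoc in Q. simpl in Q.
      rewrite !(app_nth2 a), !(app_nth2 i) in Q by lia.
      replace (length a - length a)%nat with 0%nat in Q by lia.
      replace (length a - length i)%nat with 0%nat in Q by lia.
      replace (S (length a) - length a)%nat with 1%nat in Q by lia.
      replace (S (length a) - length i)%nat with 1%nat in Q by lia. exact Q.
  - intros ((_ & P & Q) & R & T). split; [lia|split].
    + intros j Hj. destruct (Nat.eq_dec j (length i)) as [->|N].
      * now rewrite nth_middle.
      * rewrite app_nth1 by lia. apply P; lia.
    + intros j Hj. destruct (Nat.eq_dec (S j) (length a)) as [E|N].
      2:{ rewrite !app_nth1 by lia. apply Q; lia. }
      destruct a as [|c a _] using rev_ind; [easy|].
      destruct i as [|r' i _] using rev_ind; [rewrite length_app in L; simpl in L; lia|].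
      rewrite !rev_app_distr in T; simpl in T. rewrite !length_app in *; simpl in *.
      assert (j = length a) by lia. subst j.
      rewrite <- !app_assoc. simpl.
      rewrite !(app_nth2 a), !(app_nth2 i) by lia.
      replace (length a - length a)%nat with 0%nat by lia.
      replace (length a - length i)%nat with 0%nat by lia.
      replace (S (length a) - length a)%nat with 1%nat by lia.
      replace (S (length a) - length i)%nat with 1%nat by lia. exact T.
Qed.

Lemma compatible_rev i a :
  compatible a i <-> (forall r, In r i -> (1 <= r)%nat) /\ weakly_decr (rev i) /\ label_steps (rev a) (rev i).
Proof.
  revert a. induction i as [|r i IH] using rev_ind; intros a.
  - destruct a as [|b a _] using rev_ind.
    + split; [simpl; intuition|]. intros _. split; [auto|split; simpl; intros; lia].
    + rewrite rev_app_distr. simpl. split; [|tauto].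
      intros [L _]. rewrite length_app in L; simpl in L; lia.
  - destruct a as [|b a _] using rev_ind.
    + rewrite rev_app_distr. simpl. split; [|tauto].
      intros [L _]. rewrite length_app in L; simpl in L; lia.
    + destruct (Nat.eq_dec (length a) (length i)) as [L|L].
      2:{ split.
          - intros [L' _]. rewrite !length_app in L'; simpl in L'; lia.
          - intros (_ & _ & Sc). exfalso. apply L. clear L IH. rewrite !rev_app_distr in Sc.
            destruct Sc as [_ Sc]. rewrite <- (length_rev a), <- (length_rev i).
            revert Sc. generalize (rev a) (rev i). clear.
            intros l; induction l as [|c l IH]; intros [|r l']; simpl; try tauto.
            intros [_ H]. f_equal. auto. }
      rewrite compatible_rcons by auto. rewrite IH, !rev_app_distr.
      cbn [rev app weakly_decr label_steps].
      assert (In1 : (forall r0, In r0 (i ++ [r]) -> (1 <= r0)%nat) <->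
                    (forall r0, In r0 i -> (1 <= r0)%nat) /\ (1 <= r)%nat).
      { split.
        - intros Hr; split; intros; apply Hr; apply in_app_iff; simpl; auto.
        - intros [H1 H2] r0 H. apply in_app_iff in H. destruct H as [H|[<-|[]]]; auto. }
      rewrite In1. rewrite <- (length_rev a), <- (length_rev i) in L.
      destruct (rev a), (rev i); simpl in L; try discriminate; tauto.
Qed.

Lemma weakly_decr_max r ri x : weakly_decr (r :: ri) -> In x ri -> (x <= r)%nat.
Proof.
  revert r. induction ri as [|r' ri IH]; intros r [H1 H2] Hx; [easy|].
  destruct Hx as [<-|Hx]; auto. specialize (IH r' H2 Hx). lia.
Qed.

(** A monomial therefore determines its labels, and a coefficient becomes a count of words alone. *)
Lemma weakly_decr_unique s t : weakly_decr s -> weakly_decr t ->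
  (forall k, count_occ Nat.eq_dec s k = count_occ Nat.eq_dec t k) -> s = t.
Proof.
  revert t. induction s as [|r s IH]; intros [|r' t] Hs Ht E; auto.
  - specialize (E r'). simpl in E. destruct (Nat.eq_dec r' r'); congruence.
  - specialize (E r). simpl in E. destruct (Nat.eq_dec r r); congruence.
  - assert (r = r').
    { assert (I1 : In r (r' :: t)).
      { apply (count_occ_In Nat.eq_dec). rewrite <- E. apply (count_occ_In Nat.eq_dec). now left. }
      assert (I2 : In r' (r :: s)).
      { apply (count_occ_In Nat.eq_dec). rewrite E. apply (count_occ_In Nat.eq_dec). now left. }
      destruct I1 as [->|I1]; auto. destruct I2 as [->|I2]; auto.
      pose proof (weakly_decr_max _ _ _ Ht I1). pose proof (weakly_decr_max _ _ _ Hs I2). lia. }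
    subst r'. f_equal. apply IH; [apply Hs|apply Ht|].
    intros k. specialize (E k). simpl in E. destruct (Nat.eq_dec r k); lia.
Qed.

Lemma count_occ_rev (l : list nat) k : count_occ Nat.eq_dec (rev l) k = count_occ Nat.eq_dec l k.
Proof.
  induction l as [|x l IH]; simpl; auto. rewrite count_occ_app, IH. simpl.
  destruct (Nat.eq_dec x k); lia.
Qed.

(** * Counting words by a lower bound on the letter stripped first *)

Definition head_ge (b : Z) (a : list Z) : Prop :=
  match a with [] => True | c :: _ => b <= c end.

Definition rword (ri : list nat) (b : Z) (z : Z -> Z) (a : list Z) : Prop :=
  valid a z /\ label_steps a ri /\ head_ge b a.

Definition nrword (ri : list nat) (b : Z) (z : Z -> Z) : nat := ncard (rword ri b z).

Lemma fin_rword ri b z : finite (rword ri b z).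
Proof. apply (fin_sub _ _ (fin_valid z)). now intros a []. Qed.

(* Lower bound for the letter following a letter [b - 1] of label [r]: none if the label
   changes, [lo] being smaller than every letter that can occur. *)
Definition next_bound (lo : Z) (r : nat) (ri : list nat) (b : Z) : Z :=
  match ri with
  | [] => lo
  | r' :: _ => if Nat.eq_dec r' r then b else lo
  end.

(** Once [b] is stripped it is an ascent, so the next letter [c] differs from [b]; within a row,
    [b <= c] thus means [b + 1 <= c]. When the label drops, the step condition holds by itself and
    the bound is below the whole window. *)
Lemma label_steps_cons N r ri b a z : weakly_decr (r :: ri) -> fpf z -> supp N z -> desc z b ->
  valid a (cj b z) ->
  (label_steps (b :: a) (r :: ri) <-> label_steps a ri /\ head_ge (next_bound (1 - 2 * N) r ri (b + 1)) a).
Proof.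
  intros [Hr _] F S D V. cbn [label_steps].
  destruct a as [|c a], ri as [|r' ri]; cbn [label_steps head_ge next_bound]; try tauto.
  assert (W : window N c).
  { apply (valid_window N (c :: a) (cj b z)); auto using fpf_tconj.
    - now apply desc_supp. - now left. }
  assert (c <> b).
  { intros ->. destruct V as [[V _] _]. pose proof (asc_cj b z F D). lia. }
  unfold window in W. destruct (Nat.eq_dec r' r) as [->|N1].
  - split; intros [H1 H2]; split; auto; [|lia].
    destruct (Z_lt_le_dec c b) as [Hc|]; [|lia]. specialize (H1 Hc). lia.
  - split; intros [H1 H2]; split; auto; lia.
Qed.

Lemma nrword_rec N r ri b z : weakly_decr (r :: ri) -> fpf z -> supp N z ->
  nrword (r :: ri) b z =
  (nrword (r :: ri) (b + 1) z + strip b (nrword ri (next_bound (1 - 2 * N) r ri (b + 1))) z)%nat.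
Proof.
  intros Hr F S. unfold nrword at 1, ncard.
  rewrite (fsum_split _ (head_ge (b + 1)) _ (fin_rword _ _ _)). f_equal.
  - apply fsum_ext; auto. intros a. unfold rword. split; [tauto|]. intros (V & T & G).
    repeat split; auto. destruct a; simpl in *; auto; lia.
  - set (R := rword ri (next_bound (1 - 2 * N) r ri (b + 1))). unfold strip. destruct excluded_middle_informative as [D|D].
    + apply (fsum_bij (R (cj b z)) _ (cons b) (@tl Z) (fun _ => 1%nat)).
      * intros a (V & T & G). split; auto. split; [|simpl; lia]. split; [|split].
        -- now split.
        -- apply (label_steps_cons N _ _ _ _ z); auto.
        -- simpl; lia.
      * intros [|c a] [(V & T & G) G']; [simpl in G'; tauto|].
        assert (c = b) by (simpl in *; lia). subst c. destruct V as [_ V]. split; auto.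
        simpl tl. apply (label_steps_cons N) with (z := z) in T; auto. destruct T. split; auto.
    + apply fsum_0. intros [|c a] [(V & T & G) G']; [simpl in G'; tauto|].
      assert (c = b) by (simpl in *; lia). subst c. destruct V; tauto.
Qed.

Lemma nrword_large N r ri b z : fpf z -> supp N z -> b > 2 * N -> nrword (r :: ri) b z = 0%nat.
Proof.
  intros F S Hb. apply fsum_0. intros [|c a] (V & T & G); [easy|].
  exfalso. simpl in G. pose proof (valid_window N _ z F S V c (or_introl eq_refl)) as W.
  unfold window in W. lia.
Qed.

Lemma fin_A_FPF z : in_FZ z -> finite (A_FPF z).
Proof.
  intros H. destruct (fin_valid z) as [s [_ Hs]].
  apply (fin_incl _ (map (fun a => word_perm (rev a)) s)). intros w A.
  destruct (word_exists w (proj1 A)) as (a & L & ->).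
  assert (R : reduced_word (word_perm a) a) by now split.
  pose proof (proj1 (atom_reduced_word z _ a H) (conj A R)) as [V _].
  apply in_map_iff. exists (rev a). now rewrite rev_involutive, Hs.
Qed.

(** The bound [1 - 2 * N] excludes nothing, since all letters lie in the window. *)
Lemma Fhat_nrword N z i e : in_FZ z -> supp N z -> weakly_decr (rev i) ->
  (forall r, In r i -> (1 <= r)%nat) -> monomial_of i e ->
  FhatFPF_coeff z e = nrword (rev i) (1 - 2 * N) z.
Proof.
  intros H Sz Di Pi Mi. unfold FhatFPF_coeff, stanley_coeff.
  set (Q := fun a => valid (rev a) z /\ label_steps (rev a) (rev i)).
  rewrite (fsum_ext _ (A_FPF z) _ (fun w => ncard (fun a => Q a /\ word_perm a = w))); [|tauto|].
  - rewrite fsum_fibres.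
    + apply (fsum_bij _ Q (@rev Z) (@rev Z) (fun _ => 1%nat)).
      * intros a (V & T & _). unfold Q. now rewrite rev_involutive.
      * intros a [V T]. rewrite rev_involutive. split; auto. split; [auto|split; auto].
        pose proof (valid_window N _ z (FZ_fpf z H) Sz V) as W.
        destruct (rev a) as [|c l]; cbn [head_ge]; auto. specialize (W c (or_introl eq_refl)).
        unfold window in W. lia.
    + now apply fin_A_FPF.
    + destruct (fin_valid z) as [s [_ Hs]]. apply (fin_incl _ (map (@rev Z) s)).
      intros a [V _]. apply in_map_iff. exists (rev a). now rewrite rev_involutive, Hs.
    + intros a [V _]. apply (atom_reduced_word z _ a H). now split.
  - intros w A. apply (fsum_bij _ _ (fun a => (a, i)) fst (fun _ => 1%nat)).
    + intros a [[V T] E]. cbn [fst snd]. split; auto.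
      destruct (proj2 (atom_reduced_word z w a H) (conj V E)) as [_ R].
      split; [exact R|split; auto]. apply compatible_rev. auto.
    + intros [a i'] (R & C & M). cbn [fst snd] in *.
      apply compatible_rev in C. destruct C as (_ & D' & C').
      assert (E : i' = i).
      { rewrite <- (rev_involutive i'), <- (rev_involutive i). f_equal.
        apply weakly_decr_unique; auto. intros k. rewrite !count_occ_rev, <- M, <- Mi. auto. }
      subst i'. destruct (proj1 (atom_reduced_word z w a H) (conj A R)).
      unfold Q. auto.
Qed.

(** Such an [e] has infinite support or [e 0 <> 0], so it is the exponent vector of no monomial in
    [x_1, x_2, ...]. *)
Lemma Fhat_no_labels z e :
  ~ (exists i, weakly_decr (rev i) /\ (forall r, In r i -> (1 <= r)%nat) /\ monomial_of i e) ->
  FhatFPF_coeff z e = 0%nat.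
Proof.
  intros N. apply fsum_0. intros w _. apply fsum_0. intros [a i] (_ & C & M).
  elim N. exists i. cbn [fst snd] in *. apply compatible_rev in C. tauto.
Qed.

(** * Vanishing of the signed sum of covers *)

Definition window_cycle (N : Z) (y : Z -> Z) (p q : Z) : Prop :=
  in_FZ y /\ supp N y /\ window N p /\ window N q /\ y p = q /\ p < q.

Lemma Psi_window N y p q z : window_cycle N y p q -> Psi Z.lt y q z \/ Psi Z.gt y p z ->
  in_FZ z /\ supp (N + 1) z.
Proof.
  intros (H & S & Wp & Wq & E & L) P.
  assert (J : exists r j, window N r /\ window (N + 1) j /\ z = tconj r j y).
  { destruct P as [P|P].
    - destruct (Psi_lt_bound N y p q z) as (j & W & ->); eauto.
    - destruct (Psi_gt_bound N y p q z) as (j & W & ->); eauto. }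
  destruct J as (r & j & Wr & Wj & ->). split; [now apply FZ_tconj|].
  apply supp_tconj; auto using FZ_fpf.
  - eapply supp_mono; [|eauto]; lia.
  - unfold window in *; lia.
Qed.

Lemma fin_Psi_lt N y p q : window_cycle N y p q -> finite (Psi Z.lt y q).
Proof.
  intros (H & S & Wp & Wq & E & L).
  destruct (fin_Zint (1 - 2 * (N + 1)) (2 * (N + 1))) as [l Hl].
  apply (fin_incl _ (map (fun j => tconj q j y) l)). intros z P.
  destruct (Psi_lt_bound N y p q z) as (j & W & ->); auto.
  apply in_map_iff. exists j. split; auto.
Qed.

Lemma fin_Psi_gt N y p q : window_cycle N y p q -> finite (Psi Z.gt y p).
Proof.
  intros (H & S & Wp & Wq & E & L).
  destruct (fin_Zint (1 - 2 * (N + 1)) (2 * (N + 1))) as [l Hl].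
  apply (fin_incl _ (map (fun j => tconj p j y) l)). intros z P.
  destruct (Psi_gt_bound N y p q z) as (j & W & ->); auto.
  apply in_map_iff. exists j. split; auto.
Qed.

Lemma window_cycle_cj N y p q i : window_cycle N y p q -> desc y i -> window_cycle N (cj i y) (s_ i p) (s_ i q).
Proof.
  intros (H & S & Wp & Wq & E & L) D. pose proof (FZ_fpf y H) as F.
  destruct (desc_window N y i F S D) as [W1 W2].
  refine (conj _ (conj _ (conj _ (conj _ (conj _ _))))).
  - now apply FZ_tconj.
  - now apply supp_tconj.
  - transp_cases; auto.
  - transp_cases; auto.
  - now rewrite cjE, s_invol, E.
  - apply s_lt; auto. intros [-> ->]. now destruct D.
Qed.

Definition mem (p q i : Z) : Z := if (i =? p) || (i =? q) then 1 else 0.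

Lemma iverson_mem (P : Prop) p q i n : (P <-> i = p \/ i = q) ->
  Z.of_nat (iverson P n) = mem p q i * Z.of_nat n.
Proof.
  intros E. unfold mem. destruct (Z.eqb_spec i p), (Z.eqb_spec i q); cbn [orb];
  ((rewrite iverson_1 by tauto) || (rewrite iverson_0 by tauto)); lia.
Qed.

Lemma mem_s p q i : mem (s_ i p) (s_ i q) i = mem p q (i + 1).
Proof. unfold mem. transp_cases; reflexivity. Qed.

Lemma mem_s' p q i : mem (s_ i p) (s_ i q) (i + 1) = mem p q i.
Proof. unfold mem. transp_cases; reflexivity. Qed.

Lemma mem_out N p q i : window N p -> window N q -> ~ window N i -> mem p q i = 0.
Proof. intros Wp Wq W. unfold mem. transp_cases; tauto. Qed.

(** The functional [g] evaluated on the signed sum [M(y, C)] of the overview. *)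
Definition monk (y : Z -> Z) (p q : Z) (g : (Z -> Z) -> nat) : Z :=
  Z.of_nat (fsum (Psi Z.lt y q) g) - Z.of_nat (fsum (Psi Z.gt y p) g).

Lemma monk_strip N y p q i g : window_cycle N y p q ->
  monk y p q (strip i g) =
  (if excluded_middle_informative (desc y i) then monk (cj i y) (s_ i p) (s_ i q) g else 0)
  + (mem p q i - mem p q (i + 1)) * Z.of_nat (g y).
Proof.
  intros C. pose proof (fin_Psi_lt N y p q C) as F1. pose proof (fin_Psi_gt N y p q C) as F2.
  pose proof C as (H & S & Wp & Wq & E & L). pose proof (FZ_fpf y H) as F.
  pose proof F as [I NF]. unfold monk.
  assert (SL : side Z.lt) by now left. assert (SG : side Z.gt) by now right.
  destruct excluded_middle_informative as [D|D].
  - pose proof (window_cycle_cj N y p q i C D) as C'.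
    pose proof (fin_Psi_lt N _ _ _ C') as F1'. pose proof (fin_Psi_gt N _ _ _ C') as F2'.
    rewrite <- (Psi_desc Z.lt y q i g), <- (Psi_desc Z.gt y p i g), !Nat2Z.inj_add by auto.
    destruct C' as (H' & S' & Wp' & Wq' & E' & L').
    pose proof (asc_cj i y F D) as A.
    (* Applied to [cj i y], which ascends at [i] and whose conjugate is [y]: this decides whether
       [y] is the exceptional cover in [Psi_desc]. *)
    pose proof (Psi_lt_cj _ _ _ i H' E' L' A) as X1. pose proof (Psi_gt_cj _ _ _ i H' E' L' A) as X2.
    rewrite tconj_invol in X1, X2.
    rewrite (iverson_mem _ _ _ _ _ X1), (iverson_mem _ _ _ _ _ X2), mem_s, mem_s'. lia.
  - destruct (trichotomy y i F) as [A|[A|A]]; [| |tauto].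
    + rewrite (Psi_asc Z.lt), (Psi_asc Z.gt) by auto.
      rewrite (iverson_mem _ _ _ _ _ (Psi_lt_cj y p q i H E L A)).
      rewrite (iverson_mem _ _ _ _ _ (Psi_gt_cj y p q i H E L A)). lia.
    + rewrite (Psi_pair Z.lt), (Psi_pair Z.gt) by auto.
      assert (A' : y (i + 1) = i) by (rewrite <- A; apply I).
      assert (Eq : y q = p) by (rewrite <- E; apply I).
      (* Here [i] and [i + 1] are partners, so the cycle contains both or neither. *)
      assert (mem p q i = mem p q (i + 1)); [|lia].
      unfold mem. destruct (Z.eqb_spec i p) as [M0|N1], (Z.eqb_spec (i + 1) p) as [M1|N2],
        (Z.eqb_spec i q) as [M3|N3], (Z.eqb_spec (i + 1) q) as [M4|N4];
      cbn [orb]; auto; exfalso; congruence || lia.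
Qed.

Lemma monk_ext y p q f g :
  (forall z, Psi Z.lt y q z \/ Psi Z.gt y p z -> f z = g z) -> monk y p q f = monk y p q g.
Proof.
  intros H. unfold monk. rewrite (fsum_ext (Psi Z.lt y q) (Psi Z.lt y q) f g) by intuition auto.
  rewrite (fsum_ext (Psi Z.gt y p) (Psi Z.gt y p) f g) by intuition auto. reflexivity.
Qed.

Lemma monk_add N y p q f g : window_cycle N y p q ->
  monk y p q (fun z => f z + g z)%nat = monk y p q f + monk y p q g.
Proof.
  intros C. unfold monk. rewrite !fsum_add by ((eapply fin_Psi_lt; now eauto) || (eapply fin_Psi_gt; now eauto)).
  lia.
Qed.

Lemma monk_0 y p q f :
  (forall z, Psi Z.lt y q z \/ Psi Z.gt y p z -> f z = 0%nat) -> monk y p q f = 0.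
Proof. intros H. unfold monk. rewrite !fsum_0; auto. Qed.

(* The defect [mem p q b * ...] vanishes at both ends of a row of equal labels, where [b]
   lies outside the window. *)
Lemma monk_nrword N ri : forall r, weakly_decr (r :: ri) -> forall m y p q,
  let b := 2 * (N + 1) + 1 - Z.of_nat m in
  window_cycle N y p q ->
  monk y p q (nrword (r :: ri) b)
  = mem p q b * Z.of_nat (nrword ri (next_bound (1 - 2 * (N + 1)) r ri b) y).
Proof.
  induction ri as [|r' ri IHri]; intros r Hr m;
  (* The index [b] runs downwards: [m = 0] is the first index above [window (N + 1)], where no
     nonempty word can start. *)
  (induction m as [|m IHm]; intros y p q b C; pose proof C as (H & Sy & Wp & Wq & E & L);
   [rewrite monk_0, (mem_out N) by
      (auto || (unfold b, window; lia) ||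
       (intros z Hz; destruct (Psi_window N y p q z C Hz);
        apply (nrword_large (N + 1)); [auto using FZ_fpf|auto|unfold b; lia])); lia|]).
  all: specialize (IHm y p q C); cbv zeta in IHm;
    replace (2 * (N + 1) + 1 - Z.of_nat m) with (b + 1) in IHm by (unfold b; lia).
  all: rewrite (monk_ext _ _ _ _ (fun z => nrword (r :: _) (b + 1) z +
       strip b (nrword _ (next_bound (1 - 2 * (N + 1)) r _ (b + 1))) z)%nat) by
      (intros z Hz; destruct (Psi_window N y p q z C Hz); apply nrword_rec; auto using FZ_fpf).
  all: rewrite (monk_add N), (monk_strip N), IHm by auto.
  (* No labels remain, so only [Theta] would have a word; but a cover has positive length. *)
  - replace (if excluded_middle_informative _ then _ else 0) with 0; [cbn [next_bound]; lia|].
    destruct excluded_middle_informative as [D|D]; auto. symmetry. apply monk_0.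
    intros z Hz. apply fsum_0. intros [|c a] (V & T & _); [|easy].
    simpl in V. subst z. assert (ellhat_FPF Theta = ellhat_FPF (cj b y) + 1)%nat
      by (destruct Hz as [(_ & X & _)|(_ & X & _)]; auto).
    rewrite ellhat_Theta in *. lia.
  - assert (Hr' : weakly_decr (r' :: ri)) by apply Hr.
    assert (Sy' : supp (N + 1) y) by (eapply supp_mono; [|eauto]; lia).
    cbn [next_bound]. destruct (Nat.eq_dec r' r) as [->|Nr].
    + rewrite (nrword_rec (N + 1) r ri b y) by auto using FZ_fpf.
      unfold strip at 1. destruct excluded_middle_informative as [D|D]; [|lia].
      (* The row continues. The hypothesis for [cj b y] at [b + 1] carries the factor [mem p q b] by
         [mem_s'] and counts the words of [y] beginning with [b], the missing summand of
         [nrword_rec]. *)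
      pose proof (window_cycle_cj N y p q b C D) as C'.
      pose proof (IHri r Hr' m _ _ _ C') as X. cbv zeta in X.
      replace (2 * (N + 1) + 1 - Z.of_nat m) with (b + 1) in X by (unfold b; lia).
      rewrite X, mem_s'. lia.
    + replace (if excluded_middle_informative _ then _ else 0) with 0; [lia|].
      destruct excluded_middle_informative as [D|D]; auto.
      pose proof (window_cycle_cj N y p q b C D) as C'.
      assert (N1 : 1 <= N) by (unfold window in *; lia).
      (* A new row starts at the bottom of [window (N + 1)], which has [4 * (N + 1)] points. That
         index lies outside [window N], hence outside the cycle, and the defect vanishes. *)
      pose proof (IHri r' Hr' (Z.to_nat (4 * (N + 1))) _ _ _ C') as X. cbv zeta in X.
      replace (2 * (N + 1) + 1 - Z.of_nat (Z.to_nat (4 * (N + 1)))) with (1 - 2 * (N + 1)) in X by lia.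
      rewrite X, (mem_out N); [lia|apply C'|apply C'|unfold window; lia].
Qed.

Lemma PsiPlus_Psi y q z : PsiPlus y q z <-> Psi Z.lt y q z.
Proof.
  split; intros (H & E & j & L & C); (split; [auto|split; [auto|exists j; split; [lia|]]]).
  - apply functional_extensionality. exact C.
  - intros x. now rewrite C.
Qed.

Lemma PsiMinus_Psi y p z : PsiMinus y p z <-> Psi Z.gt y p z.
Proof.
  split; intros (H & E & j & L & C); (split; [auto|split; [auto|exists j; split; [lia|]]]).
  - rewrite tconj_sym. apply functional_extensionality. exact C.
  - intros x. rewrite tconj_sym in C. now rewrite C.
Qed.

(* Equality of formal power series, coefficient by coefficient:
   sum_{z in Ψ^-(y,p)} \hat F^FPF_z = sum_{z in Ψ^+(y,q)} \hat F^FPF_z. *)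
Theorem theorem2p12 (y : Z -> Z) (p q : Z) :
  in_FZ y -> y p = q -> p < q ->
  forall e : nat -> nat,
    fsum (PsiMinus y p) (fun z => FhatFPF_coeff z e) =
    fsum (PsiPlus y q) (fun z => FhatFPF_coeff z e).
Proof.
  intros H E L e.
  rewrite (fsum_ext (PsiMinus y p) (Psi Z.gt y p) _ (fun z => FhatFPF_coeff z e))
    by auto using PsiMinus_Psi.
  rewrite (fsum_ext (PsiPlus y q) (Psi Z.lt y q) _ (fun z => FhatFPF_coeff z e))
    by auto using PsiPlus_Psi.
  destruct (classic (exists i, weakly_decr (rev i) /\ (forall r, In r i -> (1 <= r)%nat) /\ monomial_of i e))
    as [(i & Di & Pi & Mi)|N0].
  2:{ rewrite !fsum_0; auto using Fhat_no_labels. }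
  destruct (FZ_supp_window y p q H) as (N & S & Wp & Wq).
  assert (C : window_cycle N y p q) by (unfold window_cycle; auto 10).
  assert (M : monk y p q (fun z => FhatFPF_coeff z e) = 0); [|unfold monk in M; lia].
  (* The covers are only supported on [window (N + 1)], so the full count starts at its lowest
     index, which the cycle in [window N] misses. *)
  rewrite (monk_ext _ _ _ _ (nrword (rev i) (1 - 2 * (N + 1)))).
  2:{ intros z Hz. destruct (Psi_window N y p q z C Hz). now apply Fhat_nrword. }
  destruct (rev i) as [|r ri].
  - apply monk_0. intros z Hz. apply fsum_0. intros [|c a] (V & T & _); [|easy].
    simpl in V. subst z. assert (ellhat_FPF Theta = ellhat_FPF y + 1)%nat
      by (destruct Hz as [(_ & X & _)|(_ & X & _)]; auto).
    rewrite ellhat_Theta in *. lia.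
  - pose proof (monk_nrword N ri r Di (Z.to_nat (4 * (N + 1))) y p q C) as X. cbv zeta in X.
    assert (N1 : 1 <= N) by (unfold window in *; lia).
    replace (2 * (N + 1) + 1 - Z.of_nat (Z.to_nat (4 * (N + 1)))) with (1 - 2 * (N + 1)) in X by lia.
    rewrite X, (mem_out N); auto. unfold window; lia.
Qed.
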